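(* For any $M>0$, $R>0$ and $d\in\mathbb{N}^*$ there exists $C>0$ such that the following holds. Let $\mu,\nu$ be probability measures on $\mathbb{R}^d$ compactly supported in $B_R$, such that $\mu$ has a density with respect to Lebesgue measure upper bounded by $M$. For positive integers $n,m$, let $X_1,\ldots,X_n$ and $Y_1,\ldots,Y_m$ be i.i.d. random samples with respective distributions $\mu$ and $\nu$, and let $\hat\mu_n=\frac1n\sum_{i=1}^n\delta_{X_i}$, $\hat\nu_m=\frac1m\sum_{i=1}^m\delta_{Y_i}$. Let $\hat\gamma_{n,m}$ be an optimal coupling for $\hat\mu_n,\hat\nu_m$ and $\gamma$ be an optimal coupling for $\mu,\nu$. Then $$\mathbb{E}\left[W_2(\gamma,\hat\gamma_{n,m})\right]\le C\begin{cases}\left(n^{-1/4}+m^{-1/4}\right)^{1/8}&\text{if } d<4,\\ \left(n^{-1/4}\sqrt{\log(1+n)}+m^{-1/4}\sqrt{\log(1+m)}\right)^{1/8}&\text{if } d=4,\\ \left(n^{-1/d}+m^{-1/d}\right)^{1/8}&\text{if } d>4.\end{cases}$$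
   Context: $B_R$ is the open Euclidean ball of $\mathbb{R}^d$ centered at $0$ with radius $R$. An optimal coupling for compactly supported probability measures $\alpha,\beta$ on $\mathbb{R}^d$ is a minimizer of $\int\frac12\|x-y\|^2d\gamma(x,y)$ over probability measures $\gamma$ on $\mathbb{R}^d\times\mathbb{R}^d$ with marginals $\alpha$ and $\beta$. $W_2$ is the 2-Wasserstein distance for the Euclidean norm (here on $\mathbb{R}^d\times\mathbb{R}^d\simeq\mathbb{R}^{2d}$). *)

(* Defs.v *)
From HB Require Import structures.
From mathcomp Require Import all_boot all_order all_algebra.
From mathcomp Require Import all_classical all_reals all_analysis.
From mathcomp Require Import measurable_realfun.

Set Implicit Arguments.
Unset Strict Implicit.
Unset Printing Implicit Defensive.

Import Order.TTheory GRing.Theory Num.Theory.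
Import numFieldNormedType.Exports.

Local Open Scope classical_set_scope.
Local Open Scope ring_scope.

(* R^n is 'rV[R]_n with R : realType. Its topology comes from the library; it is
   equipped here with the corresponding Borel sigma-algebra. *)

Definition borel_rV_display : measure_display.
Proof. exact: default_measure_display. Qed.

Section borel_rV.
Context (R : realType) (n : nat).

Definition borel_rV : set (set 'rV[R]_n) := <<s @open 'rV[R]_n >>.

Let borel_rV0 : borel_rV set0.
Proof. exact: sigma_algebra0. Qed.

Let borel_rVC A : borel_rV A -> borel_rV (~` A).
Proof. exact: sigma_algebraC. Qed.

Let borel_rV_bigcup (F : (set 'rV[R]_n)^nat) :
  (forall i, borel_rV (F i)) -> borel_rV (\bigcup_i (F i)).
Proof. exact: sigma_algebra_bigcup. Qed.

HB.instance Definition _ := @isMeasurable.Build borel_rV_display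
  'rV[R]_n borel_rV borel_rV0 borel_rVC borel_rV_bigcup.

End borel_rV.


Section coordinates.
Context (R : realType) (n : nat).

Lemma measurable_coord (i : 'I_n) :
  measurable_fun [set: 'rV[R]_n] (fun x : 'rV[R]_n => x ord0 i).
Proof.
apply: (measurability _ (RGenOpens.measurableE R)) => _ [_ [a [b ->]] <-].
rewrite setTI; apply: sub_sigma_algebra.
have /continuousP := @coord_continuous R 1 n ord0 i.
by apply; exact: interval_open.
Qed.

Let box (p : 'rV[rat]_n * nat) : set 'rV[R]_n :=
  [set x | forall i, `|ratr (p.1 ord0 i) - x ord0 i| < p.2.+1%:R^-1].

Lemma measurable_fun_rVP d (T : measurableType d) (f : T -> 'rV[R]_n) :
  measurable_fun [set: T] f <->
  forall i, measurable_fun [set: T] (fun t => f t ord0 i).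
Proof.
split=> [mf i|mf].
  exact: (measurableT_comp (measurable_coord i) mf).
have mbox p : measurable (f @^-1` box p).
  pose I (i : 'I_n) : set R := [set` `]ratr (p.1 ord0 i) - p.2.+1%:R^-1,
    ratr (p.1 ord0 i) + p.2.+1%:R^-1[].
  rewrite (_ : _ @^-1` _ = \bigcap_(i in [set: 'I_n])
     ((fun t => f t ord0 i) @^-1` I i)).
    apply: fin_bigcap_measurable => // i _.
    rewrite -[X in measurable X]setTI; apply: mf => //; exact: measurable_itv.
  apply/seteqP; split=> t bt i; have := bt i.
    by rewrite ltr_distlC /I /= in_itv /= => H _; exact: H.
  by move=> /(_ Logic.I); rewrite ltr_distlC /I /= in_itv.
apply: (@measurability _ _ _ _ _ f (@open 'rV[R]_n)) => // _ [U oU <-].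
rewrite setTI.
rewrite (_ : f @^-1` U = \bigcup_(k in [set k | exists2 p,
   unpickle k = Some p & box p `<=` U])
   (f @^-1` box (odflt (0, 0%N) (unpickle k)))).
  by apply: bigcup_measurable => k _; exact: mbox.
apply/seteqP; split=> [t Ut|t [k [p -> pU]] /= /pU//].
move: oU; rewrite openE => /(_ _ Ut)/nbhs_ballP[e /= e0 eU].
have [k ke] : exists k : nat, k.+1%:R^-1 < e / 2.
  have /ltr_add_invr[k] : 0 < e / 2 by rewrite divr_gt0.
  by rewrite add0r; exists k.
have /choice[q Hq] : forall i : 'I_n, exists q : rat,
    `|ratr q - f t ord0 i| < k.+1%:R^-1.
  move=> i; have /rat_in_itvoo[q] : f t ord0 i < f t ord0 i + k.+1%:R^-1 :> R.
    by rewrite ltrDl invr_gt0.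
  rewrite in_itv /= => /andP[q1 q2]; exists q.
  by rewrite ger0_norm ?subr_ge0 1?ltW// ltrBlDl.
pose p : 'rV[rat]_n * nat := (\row_i q i, k).
have ft : box p (f t) by move=> i; rewrite mxE; exact: Hq.
exists (pickle p); last by rewrite pickleK.
exists p; first by rewrite pickleK.
move=> x xp; apply: eU; split=> // i j; rewrite !ord1 /ball /=.
rewrite [e]splitr -(subrKA (ratr (q j))) (le_lt_trans (ler_normD _ _))//.
by rewrite ltrD// (lt_trans _ ke)//; [rewrite distrC; exact: Hq|have := xp j; rewrite mxE].
Qed.

End coordinates.

Section rV_cons.
Context (R : realType) (n : nat).

Definition rV_cons (p : measurableTypeR R * 'rV[R]_n) : 'rV[R]_n.+1 :=
  row_mx (p.1%:M : 'rV_1) p.2.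

Definition rV_uncons (x : 'rV[R]_n.+1) : measurableTypeR R * 'rV[R]_n :=
  (x ord0 ord0, \row_i x ord0 (lift ord0 i)).

Lemma rV_cons0 p : rV_cons p ord0 ord0 = p.1.
Proof.
have -> : ord0 = lshift n (ord0 : 'I_1) by exact/val_inj.
by rewrite /rV_cons (row_mxEl (p.1%:M : 'rV_1) p.2) mxE.
Qed.

Lemma rV_consS p i : rV_cons p ord0 (lift ord0 i) = p.2 ord0 i.
Proof.
have -> : lift ord0 i = rshift 1 i by exact/val_inj.
exact: (row_mxEr (p.1%:M : 'rV_1) p.2).
Qed.

Lemma rV_consK : cancel rV_cons rV_uncons.
Proof.
move=> [a x]; rewrite /rV_uncons rV_cons0; congr pair.
by apply/rowP => i; rewrite mxE rV_consS.
Qed.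

Lemma measurable_rV_cons : measurable_fun [set: measurableTypeR R * 'rV[R]_n] rV_cons.
Proof.
apply/measurable_fun_rVP => i; have [j ->|->] := unliftP ord0 i.
  under eq_fun do rewrite rV_consS.
  exact: (measurableT_comp (measurable_coord j) measurable_snd).
under eq_fun do rewrite rV_cons0.
exact: measurable_fst.
Qed.

Lemma measurable_rV_uncons : measurable_fun [set: 'rV[R]_n.+1] rV_uncons.
Proof.
apply/measurable_fun_pairP; split; first exact: measurable_coord.
apply/measurable_fun_rVP => i.
rewrite (_ : (fun t => _) = fun x : 'rV[R]_n.+1 => x ord0 (lift ord0 i)).
  exact: measurable_coord.
by apply/funext => x /=; rewrite mxE.
Qed.

End rV_cons.

Section lebesgue_rV.
Context (R : realType).

Section step.
Context (n : nat) (m : {sigma_finite_measure set 'rV[R]_n -> \bar R}).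

Definition lebesgue_rV_step : set 'rV[R]_n.+1 -> \bar R :=
  pushforward (@lebesgue_measure R \x m)%E (@rV_cons R n).

Let lebesgue_rV_step0 : lebesgue_rV_step set0 = 0%E.
Proof. by rewrite /lebesgue_rV_step /pushforward preimage_set0 measure0. Qed.

Let lebesgue_rV_step_ge0 A : (0 <= lebesgue_rV_step A)%E.
Proof. by rewrite /lebesgue_rV_step /pushforward; exact: measure_ge0. Qed.

Let mcons (A : set 'rV[R]_n.+1) :
  measurable A -> measurable (@rV_cons R n @^-1` A).
Proof. by rewrite -[X in _ -> measurable X]setTI; exact: measurable_rV_cons. Qed.

Let lebesgue_rV_step_sigma_additive : semi_sigma_additive lebesgue_rV_step.
Proof.
move=> F mF tF mUF; rewrite /lebesgue_rV_step /pushforward preimage_bigcup.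
apply: measure_semi_sigma_additive.
- by move=> k; exact: mcons.
- apply/trivIsetP => /= i j _ _ ij; rewrite -preimage_setI.
  by move/trivIsetP : tF => /(_ _ _ _ _ ij) ->//; rewrite preimage_set0.
- by rewrite -preimage_bigcup; exact: mcons.
Qed.

HB.instance Definition _ := isMeasure.Build _ _ _ lebesgue_rV_step
  lebesgue_rV_step0 lebesgue_rV_step_ge0 lebesgue_rV_step_sigma_additive.

Let lebesgue_rV_step_sigma_finite : sigma_finite setT lebesgue_rV_step.
Proof.
have /sigma_finiteP[F [TF ndF Foo]] := sigma_finiteT (@lebesgue_measure R).
have /sigma_finiteP[G [TG ndG Goo]] := sigma_finiteT m.
exists (fun k => @rV_uncons R n @^-1` (F k `*` G k)) => [|k].
  rewrite -preimage_bigcup -[LHS](preimage_setT (@rV_uncons R n)).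
  congr (_ @^-1` _); apply/esym/seteqP; split=> // -[x y] _.
  have : setT x by []. have : setT y by [].
  rewrite TF TG => -[j _ Gjy] [i _ Fix].
  exists (maxn i j) => //; split.
  - by move: x Fix; exact/subsetPset/ndF/leq_maxl.
  - by move: y Gjy; exact/subsetPset/ndG/leq_maxr.
have [mF Fk] := Foo k; have [mG Gk] := Goo k; split.
  rewrite -[X in measurable X]setTI; apply: measurable_rV_uncons => //.
  exact: measurableX.
rewrite /lebesgue_rV_step /pushforward -comp_preimage.
rewrite (_ : _ \o _ = id) ?preimage_id; last first.
  by apply/funext => p; exact: rV_consK.
by rewrite product_measure1E// lte_mul_pinfty// ge0_fin_numE.
Qed.

HB.instance Definition _ := Measure_isSigmaFinite.Build _ _ _
  lebesgue_rV_step lebesgue_rV_step_sigma_finite.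

End step.

(* lebesgue_rV n.+1 is the image of the product of the one-dimensional Lebesgue
   measure with lebesgue_rV n; see lebesgue_rV_box. *)
Fixpoint lebesgue_rV (n : nat) :
    {sigma_finite_measure set 'rV[R]_n -> \bar R} :=
  if n is k.+1 then lebesgue_rV_step (lebesgue_rV k) else \d_(0 : 'rV[R]_0).

Lemma lebesgue_rV_box n (A : 'I_n -> set R) :
  (forall i, measurable (A i)) ->
  lebesgue_rV n [set x : 'rV[R]_n | forall i, A i (x ord0 i)] =
  (\prod_(i < n) lebesgue_measure (A i))%E.
Proof.
elim: n A => [|n IHn] A mA.
  by rewrite big_ord0 /= diracE mem_set//; case.
rewrite big_ord_recl -IHn => [|i]; last exact: mA.
have mB : measurable [set x : 'rV[R]_n | forall i, A (lift ord0 i) (x ord0 i)].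
  rewrite [X in measurable X](_ : _ = \bigcap_(i in [set: 'I_n])
    ((fun x : 'rV[R]_n => x ord0 i) @^-1` A (lift ord0 i))).
    apply: fin_bigcap_measurable => // i _.
    by rewrite -[X in measurable X]setTI; exact: measurable_coord.
  by apply/seteqP; split=> x Ax i //=; exact: Ax.
transitivity ((@lebesgue_measure R \x lebesgue_rV n)%E
    (A ord0 `*` [set x : 'rV[R]_n | forall i, A (lift ord0 i) (x ord0 i)])).
  2: by apply: product_measure1E => //; exact: mA.
rewrite /= /lebesgue_rV_step /pushforward; congr (_ _).
apply/seteqP; split=> [p Ap|p [Ap0 ApS] i] /=.
  split; first by have := Ap ord0; rewrite rV_cons0.
  by move=> i; have := Ap (lift ord0 i); rewrite rV_consS.
by have [j ->|->] := unliftP ord0 i; rewrite ?rV_consS ?rV_cons0.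
Qed.

End lebesgue_rV.
Arguments lebesgue_rV {R} n.

Section euclidean.
Context (R : realType).

(* The library's norm on 'rV[R]_n is the sup norm, whence a separate
   Euclidean norm. *)
Definition eucl_norm n (x : 'rV[R]_n) : R :=
  Num.sqrt (\sum_(i < n) x ord0 i ^+ 2).

Definition eucl_dist n (x y : 'rV[R]_n) : R := eucl_norm (x - y).

Definition eucl_ball n (r : R) : set 'rV[R]_n := [set x | eucl_norm x < r].

(* R^n * R^n is identified with R^(n + n) by concatenation. *)
Definition eucl_dist_prod n (p q : 'rV[R]_n * 'rV[R]_n) : R :=
  eucl_dist (row_mx p.1 p.2) (row_mx q.1 q.2).

End euclidean.

Section measures.
Context (R : realType).

Definition msupport n (mu : set 'rV[R]_n -> \bar R) : set 'rV[R]_n :=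
  [set x | forall U : set 'rV[R]_n, open U -> U x -> (0 < mu U)%E].

Definition compactly_supported_in n (mu : set 'rV[R]_n -> \bar R)
    (D : set 'rV[R]_n) : Prop :=
  compact (msupport mu) /\ msupport mu `<=` D.

Definition has_density_bounded_by n (mu : set 'rV[R]_n -> \bar R) (M : R) :
    Prop :=
  exists f : 'rV[R]_n -> R,
    [/\ measurable_fun [set: 'rV[R]_n] f,
        forall x, 0 <= f x <= M &
        forall A, measurable A ->
          mu A = (\int[lebesgue_rV n]_(x in A) (f x)%:E)%E].

Definition empirical_measure d (T : measurableType d) n (x : 'I_n -> T) :
    set T -> \bar R :=
  fun A => ((n%:R^-1)%:E * \sum_(i < n) \d_(x i) A)%E.

End measures.

Section samples.
Context d d' (Omega : measurableType d) (T : measurableType d') (R : realType).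
Context (P : probability Omega R).

Definition mutually_independent n (X : 'I_n -> {RV P >-> T}) : Prop :=
  forall (J : {set 'I_n}) (A : 'I_n -> set T),
    (forall i, measurable (A i)) ->
    P [set w | forall i, i \in J -> A i (X i w)] =
    (\prod_(i in J) P (X i @^-1` A i))%E.

Definition iid_sample n (X : 'I_n -> {RV P >-> T}) (mu : set T -> \bar R) :
    Prop :=
  mutually_independent X /\
  forall i A, measurable A -> distribution P (X i) A = mu A.

End samples.

Section optimal_transport.
Context (R : realType).

Definition is_coupling d1 d2 (T1 : measurableType d1) (T2 : measurableType d2)
    (alpha : set T1 -> \bar R) (beta : set T2 -> \bar R)
    (gamma : set (T1 * T2) -> \bar R) : Prop :=
  (forall A, measurable A -> pushforward gamma fst A = alpha A) /\
  (forall B, measurable B -> pushforward gamma snd B = beta B).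

Definition transport_cost n (gamma : set ('rV[R]_n * 'rV[R]_n) -> \bar R) :
    \bar R :=
  (\int[gamma]_z (2^-1 * eucl_dist z.1 z.2 ^+ 2)%:E)%E.

Definition optimal_coupling n (alpha beta : set 'rV[R]_n -> \bar R)
    (gamma : probability ('rV[R]_n * 'rV[R]_n)%type R) : Prop :=
  is_coupling alpha beta gamma /\
  forall gamma' : probability ('rV[R]_n * 'rV[R]_n)%type R,
    is_coupling alpha beta gamma' ->
    (transport_cost gamma <= transport_cost gamma')%E.

Definition W2 d (T : measurableType d) (dist : T -> T -> R)
    (alpha beta : set T -> \bar R) : \bar R :=
  ((ereal_inf [set (\int[pi]_z (dist z.1 z.2 ^+ 2)%:E)%E |
    pi in [set pi : probability (T * T)%type R | is_coupling alpha beta pi]])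
    `^ 2^-1)%E.

End optimal_transport.

Definition rate (R : realType) (d n m : nat) : R :=
  if (d < 4)%N then
    (n%:R `^ (- 4^-1) + m%:R `^ (- 4^-1)) `^ 8^-1
  else if d == 4 then
    (n%:R `^ (- 4^-1) * Num.sqrt (ln (1 + n%:R)) +
     m%:R `^ (- 4^-1) * Num.sqrt (ln (1 + m%:R))) `^ 8^-1
  else
    (n%:R `^ (- d%:R^-1) + m%:R `^ (- d%:R^-1)) `^ 8^-1.

(* Main.v *)
From HB Require Import structures.
Require Import Defs.
From mathcomp Require Import all_boot all_order all_algebra.
From mathcomp Require Import all_classical all_reals all_analysis.
From mathcomp Require Import measurable_realfun ring lra.

(** The proof separates a deterministic stability estimate for optimal plans from
    the rate of convergence of empirical measures on a grid.

    Stability. Let [ghat] be the optimal plan between the empirical measures. It has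
    finite support and is cyclically monotone there ([optimal_swap]), so it has dual
    potentials [phi], [psi] ([finite_optimal_potentials]): [phi] is convex and
    Lipschitz, and the Young defect [gap x y = phi x + psi y - <x, y>], which is
    nonnegative for y in the cube, vanishes almost everywhere for [ghat]. When the
    marginals are close, transporting [ghat] back to the marginals [mu], [nu] gives a
    plan with small mean defect. The optimal plan [gamma] of [mu], [nu] costs less and its defect differs
    from the cost by functions of one marginal, so its mean defect is at least as
    small. Glue [gamma] and [ghat] along nearly equal first components: y and yh are
    now both approximate subgradients of [phi] at the same x. At step t, each
    coordinate of y - yh is at most a second difference of [phi] divided by t plus the
    defects divided by t ([subgradient_gap]). The second differences of a convex
    Lipschitz function have integral of order t ^ 2 for the Lebesgue measure
    ([integral_second_diff]), hence for [mu], whose density is bounded. If delta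
    measures the distance between the marginals, the mean distance of y and yh is
    therefore of order t + delta / t, and [W2] is at most of order
    (t + delta / t) ^ (1/2) ([coupling_stability]), that is delta ^ (1/4) for the best
    t.

    Gluing. Two laws are coupled by means of the cells of a grid: the coupling has a
    density with respect to the product that depends only on the two cells, and the
    points lie in different cells with probability at most the l1 distance between the
    cell masses ([label_coupling]). The distance between the marginals is thus
    replaced by the mesh of the grid plus these l1 distances.

    Rate. By the variance of a binomial law the expected l1 distance between the cell
    masses of [mu] and of the empirical measure is of order (cells / N) ^ (1/2)
    ([expected_label_gap]). A single grid of mesh N ^ (- 1 / (2 D)) with D = max d 4
    makes delta of that order. Since delta ^ (1/4) then equals the power 1/8 of
    N ^ (- 1 / D), this is the required rate ([mesh_rate]). *)

Set Implicit Arguments.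
Unset Strict Implicit.
Unset Printing Implicit Defensive.

Import Order.TTheory GRing.Theory Num.Theory.
Import numFieldNormedType.Exports.

Local Open Scope classical_set_scope.
Local Open Scope ring_scope.

(** * Measurability and integrals *)

Lemma measurable_preT d d' (T : measurableType d) (T' : measurableType d')
    (f : T -> T') (A : set T') :
  measurable_fun setT f -> measurable A -> measurable (f @^-1` A).
Proof. by move=> mf mA; rewrite -[X in measurable X]setTI; exact: mf. Qed.

Lemma measurable_label_neq d (T : measurableType d) (L : Type) (F : finType)
    (q : L -> F) (f h : T -> L) :
  (forall k, measurable (f @^-1` (q @^-1` [set k]))) ->
  (forall k, measurable (h @^-1` (q @^-1` [set k]))) ->
  measurable [set t | q (f t) != q (h t)].
Proof.
move=> mf mh.
rewrite (_ : [set t | _] = ~` \bigcup_(k in [set: F])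
    ((f @^-1` (q @^-1` [set k])) `&` (h @^-1` (q @^-1` [set k])))).
  apply: measurableC; apply: fin_bigcup_measurable => // k _.
  exact: measurableI.
apply/seteqP; split=> t /=.
  by move=> /eqP h1 [k _ [/= h2 h3]]; apply: h1; rewrite h2 h3.
by move=> h1; apply/eqP => h2; apply: h1; exists (q (f t)).
Qed.

Lemma integral_cst_prob d (T : measurableType d) (R : realType)
    (P : probability T R) (c : R) : (\int[P]_x c%:E = c%:E)%E.
Proof. by rewrite integral_cst// [X in (_ * X)%E]probability_setT mule1. Qed.

Lemma ge0_integralD_EFin d (T : measurableType d) (R : realType)
    (P : {measure set T -> \bar R}) (f g : T -> R) :
  measurable_fun setT f -> measurable_fun setT g ->
  (forall w, 0 <= f w) -> (forall w, 0 <= g w) ->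
  (\int[P]_w (f w + g w)%:E = \int[P]_w (f w)%:E + \int[P]_w (g w)%:E)%E.
Proof.
move=> mf mg f0 g0; under eq_integral do rewrite EFinD.
by apply: ge0_integralD => //; [move=> w _; rewrite lee_fin| exact/measurable_EFinP
  | move=> w _; rewrite lee_fin | exact/measurable_EFinP].
Qed.

Lemma ge0_integralZl_fin d (T : measurableType d) (R : realType)
    (P : {measure set T -> \bar R}) (k : R) (f : T -> R) :
  measurable_fun setT f -> (forall w, 0 <= f w) -> 0 <= k ->
  (\int[P]_w (k * f w)%:E = k%:E * \int[P]_w (f w)%:E)%E.
Proof.
move=> mf f0 k0; under eq_integral do rewrite EFinM.
apply: ge0_integralZl_EFin => //; last exact/measurable_EFinP.
by move=> w _; rewrite lee_fin.
Qed.

Lemma ge0_integral_affine d (T : measurableType d) (R : realType)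
    (P : probability T R) (a b : R) (f : T -> R) :
  measurable_fun setT f -> (forall x, 0 <= f x) -> 0 <= a -> 0 <= b ->
  (\int[P]_x (a + b * f x)%:E = a%:E + b%:E * \int[P]_x (f x)%:E)%E.
Proof.
move=> mf f0 a0 b0.
rewrite ge0_integralD_EFin//; [|exact: measurable_funM|by move=> x; rewrite mulr_ge0].
by rewrite integral_cst_prob ge0_integralZl_fin.
Qed.

Lemma ge0_ae_bounded_integral d (T : measurableType d) (R : realType)
    (P : probability T R) (f : T -> R) (C : R) :
  measurable_fun setT f -> (forall x, 0 <= f x) -> 0 <= C ->
  {ae P, forall x, f x <= C} -> (\int[P]_x (f x)%:E <= C%:E)%E.
Proof.
move=> mf f0 C0 fC.
rewrite -(integral_cst_prob P C).
apply: ae_ge0_le_integral => //.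
- by move=> x _; rewrite lee_fin.
- exact/measurable_EFinP.
- by move: fC; apply: filterS => x + _; rewrite lee_fin.
Qed.

Section image_law.
Context d d' (T : measurableType d) (T' : measurableType d') (R : realType).
Context (m : {measure set T -> \bar R}) (m' : {measure set T' -> \bar R}).
Context (g : T -> T') (mg : measurable_fun setT g).
Hypothesis law : forall A, measurable A -> m (g @^-1` A) = m' A.

Lemma ge0_integral_law (f : T' -> R) :
  measurable_fun setT f -> (forall x, 0 <= f x) ->
  (\int[m]_x (f (g x))%:E = \int[m']_x (f x)%:E)%E.
Proof.
move=> mf f0.
have := @ge0_integral_pushforward _ _ _ _ R _ mg m setT (EFin \o f) measurableT.
rewrite preimage_setT => <- //.
- by apply: eq_measure_integral => A mA _; exact: law.
- exact/measurable_EFinP.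
- by move=> x _; rewrite lee_fin.
Qed.

Lemma ae_law (Q : T' -> Prop) :
  {ae m', forall x, Q x} -> {ae m, forall x, Q (g x)}.
Proof.
move=> [N [mN N0 QN]]; exists (g @^-1` N); split => //.
- by rewrite -[X in measurable X]setTI; exact: mg.
- by rewrite law.
- by move=> x /= nQ; exact: QN.
Qed.

End image_law.

(** The integral of a nonnegative function is a supremum over the simple functions
    below it, so it is monotone even when the smaller function is not
    measurable; this matters for the Wasserstein distance between a fixed plan
    and an arbitrary selection of random plans. *)
Section unmeasurable_integrand.
Context d (T : measurableType d) (R : realType) (P : {measure set T -> \bar R}).

Import HBNNSimple.

Lemma ge0_lower_integral_le (f g : T -> \bar R) :
  (forall x, 0 <= f x)%E -> (forall x, f x <= g x)%E ->
  (\int[P]_x f x <= \int[P]_x g x)%E.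
Proof.
move=> f0 fg; rewrite !ge0_integralTE//; last by move=> x; exact: le_trans (fg x).
apply: ereal_sup_le => _ [h /= hf <-].
by exists h => // x; exact: le_trans (fg x).
Qed.

Lemma ge0_ae_lower_integral_le (f g : T -> \bar R) :
  (forall x, 0 <= f x)%E -> (forall x, 0 <= g x)%E -> measurable_fun setT g ->
  {ae P, forall x, f x <= g x}%E ->
  (\int[P]_x f x <= \int[P]_x g x)%E.
Proof.
move=> f0 g0 mg [N [mN N0 fgN]].
(* the null set where the bound may fail is paid for with the value +oo *)
pose h x : \bar R := if x \in N then +oo%E else g x.
apply: (@le_trans _ _ (\int[P]_x h x)%E).
  apply: ge0_lower_integral_le => // x; rewrite /h; case: ifPn => [_|xN].
    exact: leey.
  by apply: contrapT => nfg; move: xN; rewrite notin_setE; apply; exact: fgN.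
have mh : measurable_fun setT h.
  apply: measurable_fun_ifT => //.
  apply: (measurable_fun_bool true).
  by rewrite setTI (_ : _ @^-1` _ = N)//; apply/seteqP; split=> x /=; [exact: set_mem|exact: mem_set].
rewrite le_eqVlt; apply/orP; left; apply/eqP; apply: ge0_ae_eq_integral => //.
  by move=> x _; rewrite /h; case: ifP.
exists N; split => // x /= /not_implyP[_].
by apply: contra_notP => xN; rewrite /h memNset.
Qed.

End unmeasurable_integrand.

(** * Building measures *)

Lemma measure_lincomb d (T : measurableType d) (R : realType) (I : finType)
    (c : I -> R) (m : I -> {measure set T -> \bar R}) :
  (forall i, 0 <= c i) ->
  exists M : {measure set T -> \bar R},
    (forall A, M A = (\sum_i (c i)%:E * m i A)%E) /\
    forall f, measurable_fun setT f -> (forall x, (0 <= f x)%E) ->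
      (\int[M]_x f x = \sum_i (c i)%:E * \int[m i]_x f x)%E.
Proof.
move=> c0.
pose g (k : nat) : {measure set T -> \bar R} :=
  if insub k is Some j then mscale (NngNum (c0 (enum_val (j : 'I_#|I|)))) (m (enum_val j))
  else mzero.
exists (msum g #|I|); split => [A|f mf f0].
  rewrite /= /msum [RHS](reindex_onto enum_val enum_rank) /=.
    apply: eq_big => [k|k _]; first by rewrite enum_valK eqxx.
    by rewrite /g valK.
  by move=> i _; rewrite enum_rankK.
rewrite ge0_integral_measure_sum// [RHS](reindex_onto enum_val enum_rank) /=.
  apply: eq_big => [k|k _]; first by rewrite enum_valK eqxx.
  by rewrite /g valK ge0_integral_mscale.
by move=> i _; rewrite enum_rankK.
Qed.

Section probability_of_measure.
Context d (T : measurableType d) (R : realType) (m : {measure set T -> \bar R}).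

(** A copy of [m] that carries the structure of a probability. *)
Definition unit_mass (m1 : m setT = 1%E) : set T -> \bar R := m.

Context (m1 : m setT = 1%E).
HB.instance Definition _ := Measure.on (unit_mass m1).
HB.instance Definition _ := Measure_isProbability.Build _ _ _ (unit_mass m1) m1.

Lemma probability_of_measure : exists P : probability T R, forall A, P A = m A.
Proof. by exists (unit_mass m1). Qed.

End probability_of_measure.

(** The difference is a charge, and a charge that is nonnegative on every set is a
    measure; [crestr0] makes it vanish on the nonmeasurable sets, where nothing is
    known about [m1] and [m2]. *)
Lemma measure_sub d (T : measurableType d) (R : realType)
    (m1 : {finite_measure set T -> \bar R}) (m2 : {measure set T -> \bar R}) :
  (forall A, measurable A -> (m2 A <= m1 A)%E) ->
  exists m : {measure set T -> \bar R},
    forall A, measurable A -> m A = (m1 A - m2 A)%E.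
Proof.
move=> m21.
have m2oo : (m2 setT < +oo)%E.
  by rewrite (le_lt_trans (m21 _ measurableT))// ltey_eq fin_num_measure.
pose nu : {charge set T -> \bar R} := cadd (charge_of_finite_measure m1)
  (copp (charge_of_finite_measure (mfrestr measurableT m2oo))).
have nuE A : nu A = (m1 A - m2 A)%E.
  by rewrite -[X in m2 X](setIT A).
have nu0 A : (0 <= crestr0 nu measurableT A)%E.
  rewrite /crestr0; case: ifPn => // /set_mem mA.
  rewrite /crestr setIT nuE sube_ge0 ?m21//.
  by apply/orP; right; exact: fin_num_measure.
exists (measure_of_charge _ nu0) => A mA.
by rewrite /= /measure_of_charge /crestr0 mem_set// /crestr setIT nuE.
Qed.

(** * Coupling two laws through finitely many labels *)

Section coupling_weights.
Context (R : realType) (F : finType) (a b : F -> R).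
Hypotheses (a0 : forall k, 0 <= a k) (b0 : forall k, 0 <= b k).
Hypotheses (a1 : \sum_k a k = 1) (b1 : \sum_k b k = 1).

(* [w] is the maximal coupling of [a] and [b]: the common mass [min (a k) (b k)]
   stays put, the excesses are coupled independently; [tau] is their total *)
Let ea k := a k - Num.min (a k) (b k).
Let eb k := b k - Num.min (a k) (b k).
Let tau := \sum_k ea k.
Let w k l := (k == l)%:R * Num.min (a k) (b k) + ea k * eb l / tau.

Let ea0 k : 0 <= ea k. Proof. by rewrite subr_ge0 ge_min lexx. Qed.
Let eb0 k : 0 <= eb k. Proof. by rewrite subr_ge0 ge_min lexx orbT. Qed.
Let tau0 : 0 <= tau. Proof. exact: sumr_ge0. Qed.
Let tauE : tau = \sum_k eb k.
Proof. by rewrite /tau /ea /eb !sumrB a1 b1. Qed.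

Let w0 k l : 0 <= w k l.
Proof.
rewrite addr_ge0 ?mulr_ge0 ?invr_ge0//.
by rewrite le_min a0 b0.
Qed.

Let row_sum k : \sum_l w k l = a k.
Proof.
rewrite big_split /= -(mulr_suml _ _ _ tau^-1) -mulr_sumr -tauE.
rewrite (bigD1 k)//= eqxx mul1r.
rewrite big1 ?addr0 => [|l]; last by rewrite eq_sym => /negbTE ->; rewrite mul0r.
have [t0|t0] := eqVneq tau 0.
  have /eqP := t0; rewrite psumr_eq0// => /allP/(_ k); rewrite mem_index_enum /=.
  by move=> /(_ isT)/eqP ek; rewrite ek !mul0r addr0; move/eqP: ek; rewrite subr_eq0 => /eqP.
by rewrite mulfK// /ea addrC subrK.
Qed.

Let col_sum l : \sum_k w k l = b l.
Proof.
rewrite big_split /= -(mulr_suml _ _ _ tau^-1) -(mulr_suml _ _ _ (eb l)) -/tau.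
rewrite (bigD1 l)//= eqxx mul1r.
rewrite big1 ?addr0 => [|k]; last by move=> /negbTE ->; rewrite mul0r.
have [t0|t0] := eqVneq tau 0.
  have /eqP := t0; rewrite tauE psumr_eq0// => /allP/(_ l); rewrite mem_index_enum /=.
  by move=> /(_ isT)/eqP ek; rewrite ek mulr0 !mul0r addr0; move/eqP: ek; rewrite subr_eq0 => /eqP.
by rewrite mulrAC divff// mul1r /eb addrC subrK.
Qed.

Let w_eq0 k l : a k * b l = 0 -> w k l = 0.
Proof.
move/eqP; rewrite mulf_eq0 => /orP[/eqP ak|/eqP bl].
  have /eqP := row_sum k; rewrite ak psumr_eq0// => /allP/(_ l).
  by rewrite mem_index_enum /= => /(_ isT)/eqP.
have /eqP := col_sum l; rewrite bl psumr_eq0// => /allP/(_ k).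
by rewrite mem_index_enum /= => /(_ isT)/eqP.
Qed.

(** Dividing the maximal coupling by [a k * b l] gives a density with respect to the
    product; the value 1 on cells of zero mass makes the two marginal identities
    hold at every label instead of almost every one. *)
Lemma coupling_weights : exists c : F -> F -> R,
  [/\ forall k l, 0 <= c k l,
      forall k, \sum_l c k l * b l = 1,
      forall l, \sum_k a k * c k l = 1 &
      \sum_k \sum_(l | k != l) a k * c k l * b l <= \sum_k `|a k - b k|].
Proof.
pose c k l := if a k * b l == 0 then 1 else w k l / (a k * b l).
have wE k l : a k * c k l * b l = w k l.
  rewrite /c; case: ifP => [/eqP ab|/negbT ab].
    by rewrite w_eq0// mulr1.
  by rewrite mulrAC mulrC divfK.
exists c; split => [k l|k|l|].
- by rewrite /c; case: ifP => // _; rewrite divr_ge0 ?mulr_ge0.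
- have [ak|ak] := eqVneq (a k) 0.
    by rewrite -b1; apply: eq_bigr => l _; rewrite /c ak mul0r eqxx mul1r.
  apply: (mulfI ak); rewrite mulr1 mulr_sumr -[RHS]row_sum.
  by apply: eq_bigr => l _; rewrite -wE mulrA.
- have [bl|bl] := eqVneq (b l) 0.
    by rewrite -a1; apply: eq_bigr => k _; rewrite /c bl mulr0 eqxx mulr1.
  apply: (mulIf bl); rewrite mul1r mulr_suml -[RHS]col_sum.
  by apply: eq_bigr => k _; rewrite -wE.
apply: ler_sum => k _; under eq_bigr do rewrite wE.
have -> : \sum_(l | k != l) w k l = a k - w k k.
  have := row_sum k; rewrite (bigD1 k)//= => <-; rewrite addrAC subrr add0r.
  by apply: eq_bigl => l; rewrite eq_sym.
rewrite /w eqxx mul1r opprD addrA.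
rewrite (@le_trans _ _ (a k - Num.min (a k) (b k)))//.
  by rewrite gerBl mulr_ge0 ?invr_ge0// mulr_ge0.
by case: (leP (a k) (b k)) => _; rewrite ?subrr ?normr_ge0 ?ler_norm.
Qed.

End coupling_weights.

Lemma sum_preimage_fin d (T : measurableType d) (R : realType) (F : finType)
    (m : {measure set T -> \bar R}) (q : T -> F) (A : set T) :
  (forall k, measurable (q @^-1` [set k])) -> measurable A ->
  (\sum_k m (A `&` q @^-1` [set k]))%E = m A.
Proof.
move=> mq mA; rewrite fsbig_seq ?index_enum_uniq// -measure_fin_bigcup//=.
- by congr (m _); apply/seteqP; split=> [x [k _ [Ax _]]//|x Ax]; exists (q x); rewrite //= mem_index_enum.
- apply/trivIsetP => i j _ _ ij; apply/seteqP; split=> // x [[_ /= xi] [_ /= xj]].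
  by move: ij; rewrite -xi -xj eqxx.
- by move=> k _; exact: measurableI.
Qed.

(** Twice the total variation distance between the laws of the label [q]. *)
Definition label_gap (R : realType) (T : Type) (F : finType) (q : T -> F)
    (m m' : set T -> \bar R) : R :=
  \sum_k `|fine (m (q @^-1` [set k])) - fine (m' (q @^-1` [set k]))|.

Lemma label_gap_ge0 (R : realType) (T : Type) (F : finType) (q : T -> F)
  (m m' : set T -> \bar R) : 0 <= label_gap q m m'.
Proof. exact: sumr_ge0. Qed.

Lemma label_gapC (R : realType) (T : Type) (F : finType) (q : T -> F)
  (m m' : set T -> \bar R) : label_gap q m m' = label_gap q m' m.
Proof. by apply: eq_bigr => k _; rewrite distrC. Qed.

Section label_coupling.
Context d1 d2 (T1 : measurableType d1) (T2 : measurableType d2) (R : realType).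
Context (P1 : probability T1 R) (P2 : probability T2 R).
Context (F : finType) (q1 : T1 -> F) (q2 : T2 -> F).
Hypotheses (mq1 : forall k, measurable (q1 @^-1` [set k])).
Hypotheses (mq2 : forall k, measurable (q2 @^-1` [set k])).

(** The coupling has a density with respect to the product that only depends on the
    pair of labels, so gluing couplings along labels needs no disintegration. *)
Lemma label_coupling : exists Pi : probability (T1 * T2)%type R,
  [/\ forall A, measurable A -> Pi (A `*` setT) = P1 A,
      forall B, measurable B -> Pi (setT `*` B) = P2 B &
      (Pi [set z | q1 z.1 != q2 z.2] <=
       (\sum_k `|fine (P1 (q1 @^-1` [set k])) - fine (P2 (q2 @^-1` [set k]))|)%:E)%E].
Proof.
pose a k := fine (P1 (q1 @^-1` [set k])); pose b k := fine (P2 (q2 @^-1` [set k])).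
have aE k : P1 (q1 @^-1` [set k]) = (a k)%:E by rewrite fineK// fin_num_measure.
have bE k : P2 (q2 @^-1` [set k]) = (b k)%:E by rewrite fineK// fin_num_measure.
have a0 k : 0 <= a k by exact/fine_ge0/measure_ge0.
have b0 k : 0 <= b k by exact/fine_ge0/measure_ge0.
have a1 : \sum_k a k = 1.
  apply: EFin_inj; rewrite -sumEFin -(@probability_setT _ _ _ P1).
  rewrite -(sum_preimage_fin P1 mq1 measurableT).
  by apply: eq_bigr => k _; rewrite setTI -aE.
have b1 : \sum_k b k = 1.
  apply: EFin_inj; rewrite -sumEFin -(@probability_setT _ _ _ P2).
  rewrite -(sum_preimage_fin P2 mq2 measurableT).
  by apply: eq_bigr => k _; rewrite setTI -bE.
have [c [c0 cb ac cne]] := coupling_weights a0 b0 a1 b1.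
have mC (p : F * F) : measurable ((q1 @^-1` [set p.1]) `*` (q2 @^-1` [set p.2])).
  exact: measurableX.
have [m [mE _]] := @measure_lincomb _ (T1 * T2)%type R (F * F)%type
  (fun p => c p.1 p.2) (fun p => mrestr (P1 \x P2)%E (mC p)) (fun p => c0 p.1 p.2).
have mX A B : measurable A -> measurable B ->
    m (A `*` B) = (\sum_k \sum_l (c k l)%:E *
      (P1 (A `&` q1 @^-1` [set k]) * P2 (B `&` q2 @^-1` [set l])))%E.
  move=> mA mB; rewrite mE (pair_big xpredT xpredT) /=; apply: eq_bigr => -[k l] _ /=.
  rewrite /mrestr -setXI; congr (_ * _)%E.
  by apply: product_measure1E; exact: measurableI.
have m1 A : measurable A -> m (A `*` setT) = P1 A.
  move=> mA; rewrite mX// -[RHS](sum_preimage_fin P1 mq1 mA).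
  apply: eq_bigr => k _.
  have pf : P1 (A `&` q1 @^-1` [set k]) \is a fin_num.
    by rewrite fin_num_measure//; exact: measurableI.
  transitivity ((fine (P1 (A `&` q1 @^-1` [set k])))%:E); last exact: fineK.
  rewrite -[in RHS](mulr1 (fine _)) -(cb k) mulr_sumr -sumEFin.
  by apply: eq_bigr => l _; rewrite setTI bE -[in LHS](fineK pf) -!EFinM mulrCA.
have m2 B : measurable B -> m (setT `*` B) = P2 B.
  move=> mB; rewrite mX// exchange_big /= -[RHS](sum_preimage_fin P2 mq2 mB).
  apply: eq_bigr => l _.
  have pf : P2 (B `&` q2 @^-1` [set l]) \is a fin_num.
    by rewrite fin_num_measure//; exact: measurableI.
  transitivity ((fine (P2 (B `&` q2 @^-1` [set l])))%:E); last exact: fineK.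
  rewrite -[in RHS](mul1r (fine _)) -(ac l) mulr_suml -sumEFin.
  apply: eq_bigr => k _; rewrite setTI aE -[in LHS](fineK pf) -!EFinM mulrA.
  by rewrite (mulrC (c k l)).
have mT : m setT = 1%E by rewrite -setXTT m1// probability_setT.
have [Pi PiE] := probability_of_measure mT.
exists Pi; split=> [A mA|B mB|]; rewrite PiE; [exact: m1|exact: m2|].
rewrite mE -(pair_big xpredT xpredT (fun k l => (c k l)%:E *
   mrestr (P1 \x P2) (mC (k, l)) [set z | q1 z.1 != q2 z.2]))%E /=.
apply: le_trans (_ : ((\sum_k \sum_(l | k != l) a k * c k l * b l)%:E <= _)%E); last first.
  by rewrite lee_fin.
rewrite -sumEFin; apply: lee_sum => k _; rewrite -sumEFin [leRHS]big_mkcond/=.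
apply: lee_sum => l _; case: ifPn => [kl|/negPn/eqP kl].
  have -> : (a k * c k l * b l)%:E =
    ((c k l)%:E * (P1 \x P2) (q1 @^-1` [set k] `*` q2 @^-1` [set l]))%E.
    transitivity ((c k l)%:E * ((a k)%:E * (b l)%:E))%E.
      by rewrite -!EFinM mulrA (mulrC (c k l)).
    by congr (_ * _)%E; rewrite -aE -bE; apply/esym/product_measure1E.
  apply: lee_pmul => //; first by rewrite lee_fin.
  rewrite /mrestr; apply: le_measure; rewrite ?inE//; last exact: mC (k, l).
  have -> : [set z | q1 z.1 != q2 z.2] `&` (q1 @^-1` [set k] `*` q2 @^-1` [set l]) =
            q1 @^-1` [set k] `*` q2 @^-1` [set l].
    by apply/seteqP; split=> [[x y] [_]//|[x y] [/= xk yl]]; split=> //=; rewrite xk yl.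
  exact: mC (k, l).
rewrite (_ : mrestr _ _ _ = 0%E) ?mule0// /mrestr /=.
rewrite (_ : _ `&` _ = set0) ?measure0//.
by apply/seteqP; split=> // -[x y] [/= /eqP + [xk yl]]; rewrite xk yl kl.
Qed.

End label_coupling.

(** * Vectors, the l1 distance and the cost *)

Section dot.
Context (R : realType) (n : nat).
Implicit Types x y z : 'rV[R]_n.

Definition dot x y : R := \sum_(i < n) x ord0 i * y ord0 i.
Definition dist1 x y : R := \sum_(i < n) `|x ord0 i - y ord0 i|.
Definition cube (r : R) : set 'rV[R]_n := [set x | forall i, `|x ord0 i| <= r].

Lemma dotDl x x' y : dot (x + x') y = dot x y + dot x' y.
Proof. by rewrite -big_split; apply: eq_bigr => i _; rewrite mxE mulrDl. Qed.

Lemma dotBl x x' y : dot (x - x') y = dot x y - dot x' y.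
Proof. by rewrite -sumrB; apply: eq_bigr => i _; rewrite !mxE mulrBl. Qed.

Lemma dotC x y : dot x y = dot y x.
Proof. by apply: eq_bigr => i _; rewrite mulrC. Qed.

Lemma dist1_ge0 x y : 0 <= dist1 x y.
Proof. by apply: sumr_ge0. Qed.

Lemma dist1C x y : dist1 x y = dist1 y x.
Proof. by apply: eq_bigr => i _; rewrite distrC. Qed.

Lemma dot_lip r x x' y : cube r y -> dot x y - dot x' y <= r * dist1 x x'.
Proof.
move=> yr; rewrite -dotBl mulr_sumr; apply: ler_sum => i _.
rewrite !mxE (le_trans (ler_norm _))// normrM mulrC ler_wpM2r//; exact: yr.
Qed.

Lemma dot_cube r x y : 0 <= r -> cube r x -> cube r y -> `|dot x y| <= n%:R * r ^+ 2.
Proof.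
move=> r0 xr yr; rewrite (le_trans (ler_norm_sum _ _ _))//.
rewrite (@le_trans _ _ (\sum_(i < n) r ^+ 2))//; last first.
  by rewrite sumr_const card_ord mulr_natl.
by apply: ler_sum => i _; rewrite normrM expr2 ler_pM.
Qed.

Lemma dist1_cube r x y : cube r x -> cube r y -> dist1 x y <= n%:R * (2 * r).
Proof.
move=> xr yr; rewrite (@le_trans _ _ (\sum_(i < n) (2 * r)))//; last first.
  by rewrite sumr_const card_ord -[leLHS]mulr_natl.
apply: ler_sum => i _; rewrite (le_trans (ler_normB _ _))// mulr2n mulrDl !mul1r.
by apply: lerD.
Qed.

Lemma half_eucl_distE x y :
  2^-1 * eucl_dist x y ^+ 2 = 2^-1 * dot x x + 2^-1 * dot y y - dot x y.
Proof.
rewrite /eucl_dist /eucl_norm sqr_sqrtr; last by apply: sumr_ge0 => i _; exact: sqr_ge0.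
rewrite !mulr_sumr -big_split -sumrB; apply: eq_bigr => i _ /=.
by rewrite !mxE; field.
Qed.

End dot.

Lemma half_eucl_dist_cube (R : realType) n (r : R) (x y : 'rV[R]_n) :
  0 <= r -> cube r x -> cube r y ->
  2^-1 * eucl_dist x y ^+ 2 <= 2 * (n%:R * r ^+ 2).
Proof.
move=> r0 xr yr; rewrite half_eucl_distE.
have := dot_cube r0 xr xr; have := dot_cube r0 yr yr; have := dot_cube r0 xr yr.
by rewrite !ler_norml => /andP[? ?] /andP[? ?] /andP[? ?]; lra.
Qed.

Lemma eucl_dist_prod_sqr (R : realType) n (p q : 'rV[R]_n * 'rV[R]_n) :
  eucl_dist_prod p q ^+ 2 =
  \sum_(i < n) (p.1 ord0 i - q.1 ord0 i) ^+ 2 + \sum_(i < n) (p.2 ord0 i - q.2 ord0 i) ^+ 2.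
Proof.
rewrite /eucl_dist_prod /eucl_dist /eucl_norm sqr_sqrtr; last first.
  by apply: sumr_ge0 => i _; exact: sqr_ge0.
rewrite big_split_ord /=; congr (_ + _); apply: eq_bigr => i _.
  by rewrite mxE row_mxEl mxE row_mxEl.
by rewrite mxE row_mxEr mxE row_mxEr.
Qed.

Lemma sum_sqr_dist1 (R : realType) n (r : R) (x y : 'rV[R]_n) :
  cube r x -> cube r y ->
  \sum_(i < n) (x ord0 i - y ord0 i) ^+ 2 <= 2 * r * dist1 x y.
Proof.
move=> xr yr; rewrite /dist1 mulr_sumr; apply: ler_sum => i _.
rewrite -real_normK ?num_real// expr2 ler_wpM2r// (le_trans (ler_normB _ _))//.
by rewrite mulr2n mulrDl !mul1r lerD.
Qed.

Lemma measurable_rV_box (R : realType) n (A : 'I_n -> set R) :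
  (forall i, measurable (A i)) ->
  measurable [set x : 'rV[R]_n | forall i, A i (x ord0 i)].
Proof.
move=> mA.
rewrite (_ : [set x | _] = \bigcap_(i in [set: 'I_n])
    ((fun x : 'rV[R]_n => x ord0 i) @^-1` A i)).
  apply: fin_bigcap_measurable => // i _.
  exact: measurable_preT (measurable_coord i) (mA i).
by apply/seteqP; split=> x Ax i //=; exact: Ax.
Qed.

Lemma measurable_rV1 (R : realType) n (x : 'rV[R]_n) : measurable [set x].
Proof.
rewrite (_ : [set x] = [set y | forall i, [set x ord0 i] (y ord0 i)]).
  by apply: (@measurable_rV_box _ _ (fun i => [set x ord0 i])).
apply/seteqP; split=> [y -> //|y yx].
by apply/rowP => i; exact: yx.
Qed.

Lemma measurable_rV2 (R : realType) n (s : 'rV[R]_n * 'rV[R]_n) : measurable [set s].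
Proof.
rewrite (_ : [set s] = [set s.1] `*` [set s.2]).
  by apply: measurableX; exact: measurable_rV1.
by apply/seteqP; split=> [_ -> //|[x y] [/= -> ->]]; rewrite -surjective_pairing.
Qed.

Lemma cubeE (R : realType) n (r : R) :
  cube r = [set x : 'rV[R]_n | forall i, `[- r, r]%classic (x ord0 i)].
Proof.
by apply/seteqP; split=> x xr j; have := xr j; rewrite /= in_itv/= ler_norml.
Qed.

Lemma measurable_cube (R : realType) n (r : R) : measurable (@cube R n r).
Proof. by rewrite cubeE; apply: (@measurable_rV_box _ _ (fun=> _)). Qed.

Lemma measurable_dot d (T : measurableType d) (R : realType) n
    (f g : T -> 'rV[R]_n) :
  measurable_fun setT f -> measurable_fun setT g ->
  measurable_fun setT (fun t => dot (f t) (g t)).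
Proof.
move=> /measurable_fun_rVP mf /measurable_fun_rVP mg.
by apply: measurable_sum => i; exact: measurable_funM.
Qed.

Lemma measurable_half_eucl_dist d (T : measurableType d) (R : realType) n
    (f g : T -> 'rV[R]_n) :
  measurable_fun setT f -> measurable_fun setT g ->
  measurable_fun setT (fun t => 2^-1 * eucl_dist (f t) (g t) ^+ 2).
Proof.
move=> mf mg; under eq_fun do rewrite half_eucl_distE.
apply: measurable_funB; last exact: measurable_dot.
by apply: measurable_funD; apply: measurable_funM => //; exact: measurable_dot.
Qed.

Lemma measurable_dist1 d (T : measurableType d) (R : realType) n
    (f g : T -> 'rV[R]_n) :
  measurable_fun setT f -> measurable_fun setT g ->
  measurable_fun setT (fun t => dist1 (f t) (g t)).
Proof.
move=> /measurable_fun_rVP mf /measurable_fun_rVP mg.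
apply: measurable_sum => i; apply: measurableT_comp => //.
exact: measurable_funB.
Qed.

Lemma measurable_lip1 (R : realType) n (r : R) (f : 'rV[R]_n -> R) :
  (forall x y, f x - f y <= r * dist1 x y) -> measurable_fun setT f.
Proof.
move=> flip; apply: (measurability _ (RGenOInfty.measurableE R)) => _ [_ [a ->] <-].
rewrite setTI; apply: sub_sigma_algebra; rewrite /= openE => x /=.
rewrite in_itv/= andbT => ax.
pose K := `|r| * n%:R + 1.
have K0 : 0 < K by rewrite ltr_wpDl// mulr_ge0.
apply/nbhs_ballP; exists ((f x - a) / K); first by rewrite /= divr_gt0// subr_gt0.
move=> y xy; rewrite /= in_itv/= andbT.
have D : dist1 x y <= n%:R * ((f x - a) / K).
  rewrite (@le_trans _ _ (\sum_(i < n) (f x - a) / K))//; last first.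
    by rewrite sumr_const card_ord -[leLHS]mulr_natl.
  by apply: ler_sum => i _; apply/ltW; case: xy => _ /(_ ord0 i).
have : f x - f y <= `|r| * (n%:R * ((f x - a) / K)).
  apply: le_trans (flip x y) _; apply: le_trans (_ : `|r| * dist1 x y <= _).
    by apply: ler_wpM2r; [exact: dist1_ge0|exact: ler_norm].
  exact: ler_wpM2l.
have : `|r| * (n%:R * ((f x - a) / K)) < f x - a.
  by rewrite !mulrA ltr_pdivrMr// mulrC ltr_pM2l ?subr_gt0// /K ltrDl.
lra.
Qed.

Lemma measurable_fun_shift (R : realType) n (v : 'rV[R]_n) :
  measurable_fun setT (fun x : 'rV[R]_n => x + v).
Proof.
apply/measurable_fun_rVP => i; under eq_fun do rewrite mxE.
by apply: measurable_funD => //; exact: measurable_coord.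
Qed.

(** * Dual potentials of a finitely supported optimal plan *)

Section cyclic_potential.
Context (R : realType) (T : Type) (S : set T) (w : T -> T -> R).
Hypothesis cyc : forall N (f : nat -> T), (forall i, S (f i)) ->
  \sum_(i < N) w (f i) (f i.+1) + w (f N) (f 0%N) <= 0.

(** The longest-path potential: [p s] is the supremum of the total weights of the
    chains from a base point to [s], finite because closing a chain yields a
    cycle. *)
Lemma cyclic_potential :
  exists p : T -> R, forall s s', S s -> S s' -> p s + w s s' <= p s'.
Proof.
have [/eqP S0|/set0P[s0 Ss0]] := eqVneq S set0.
  by exists (fun=> 0) => s s'; move/eqP: S0 => ->.
pose chain s := [set v | exists N (f : nat -> T), [/\ forall i, S (f i),
  f 0%N = s0, f N = s & v = \sum_(i < N) w (f i) (f i.+1)]].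
have chain_neq0 s : S s -> chain s !=set0.
  move=> Ss; exists (w s0 s), 1%N, (fun i => if i is 0%N then s0 else s).
  by split=> // [[]//|]; rewrite big_ord1.
have chain_ub s : has_ubound (chain s).
  exists (- w s s0) => _ [N [f [Sf f0 fN ->]]].
  by have := cyc N Sf; rewrite f0 fN; lra.
exists (fun s => sup (chain s)) => s s' Ss Ss'.
rewrite -lerBrDr; apply: ge_sup; first exact: chain_neq0.
move=> _ [N [f [Sf f0 fN ->]]]; rewrite lerBrDr.
apply: ub_le_sup; first exact: chain_ub.
exists N.+1, (fun i => if (i <= N)%N then f i else s'); split => //.
- by move=> i; case: ifP.
- by rewrite ltnn.
rewrite big_ord_recr /= leqnn ltnn fN; congr (_ + _).
by apply: eq_bigr => i _; rewrite (ltnW (ltn_ord i)) ltn_ord.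
Qed.

End cyclic_potential.

Section convex_conjugates.
Context (R : realType) (n : nat) (r : R) (r0 : 0 <= r).
Context (S : set ('rV[R]_n * 'rV[R]_n)) (S0 : S !=set0).
Hypothesis S_cube : S `<=` cube r `*` cube r.
Context (p : 'rV[R]_n * 'rV[R]_n -> R).
Hypothesis p_pot : forall s s', S s -> S s' -> p s + (dot s'.1 s.2 - dot s.1 s.2) <= p s'.

(* [psi] only tests the points of the plan, and [phi] is the conjugate of [psi] over
   the cube: it is finite on the whole space, with slopes in the cube *)
Let psi y := sup [set dot s.1 y - p s | s in S].
Let phi z := sup [set dot z y - psi y | y in cube r].

Let p_lb : exists C, forall s, S s -> C <= p s.
Proof.
have [s0 Ss0] := S0; exists (p s0 - 2 * (n%:R * r ^+ 2)) => s Ss.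
apply: le_trans (p_pot Ss0 Ss).
have [x0 y0] := S_cube Ss0; have [x y] := S_cube Ss.
rewrite lerD2l lerNl opprB mulr2n mulrDl !mul1r (le_trans (ler_norm _))//.
by rewrite (le_trans (ler_normB _ _))// lerD//; exact: dot_cube.
Qed.

Let psi_ub y : has_ubound [set dot s.1 y - p s | s in S].
Proof.
have [C pC] := p_lb; exists (r * dist1 y 0 - C) => _ [s Ss <-].
rewrite lerB ?pC//; have [x _] := S_cube Ss.
have := dot_lip y 0 x; rewrite !(dotC _ s.1) [X in _ - X]big1 ?subr0// => i _.
by rewrite mxE mulr0.
Qed.

Let psi_ge s y : S s -> dot s.1 y - p s <= psi y.
Proof. by move=> Ss; apply: ub_le_sup => //; exists s. Qed.

Let psi_le y M : (forall s, S s -> dot s.1 y - p s <= M) -> psi y <= M.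
Proof.
move=> H; apply: ge_sup; last by move=> _ [s Ss <-]; exact: H.
by have [s Ss] := S0; exists (dot s.1 y - p s), s.
Qed.

Let phi_ub z : has_ubound [set dot z y - psi y | y in cube r].
Proof.
have [s Ss] := S0; exists (r * dist1 z s.1 + p s) => _ [y yr <-].
by have := psi_ge y Ss; have := dot_lip z s.1 yr; lra.
Qed.

Let phi_ge z y : cube r y -> dot z y - psi y <= phi z.
Proof. by move=> yr; apply: ub_le_sup => //; exists y. Qed.

Let phi_le z M : (forall y, cube r y -> dot z y - psi y <= M) -> phi z <= M.
Proof.
move=> H; apply: ge_sup; last by move=> _ [y yr <-]; exact: H.
by exists (dot z 0 - psi 0), 0 => //= i; rewrite mxE normr0.
Qed.

(** The Young inequality holds on the whole space because [phi] is a conjugate of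
    [psi]; at a pair of [S] it is an equality because [phi s.1] is at most [p s], by
    definition of [psi], and [psi s.2] is at most [dot s.1 s.2 - p s], by the
    inequality defining the potential [p]. *)
Lemma convex_conjugates : exists phi psi : 'rV[R]_n -> R,
  [/\ forall z y, cube r y -> dot z y <= phi z + psi y,
      forall s, S s -> phi s.1 + psi s.2 <= dot s.1 s.2,
      forall z z', phi z - phi z' <= r * dist1 z z',
      forall y y', psi y - psi y' <= r * dist1 y y' &
      forall z h, 2 * phi z <= phi (z + h) + phi (z - h)].
Proof.
exists phi, psi; split.
- by move=> z y yr; rewrite -lerBlDr; exact: phi_ge.
- move=> s Ss.
  have h1 : phi s.1 <= p s by apply: phi_le => y yr; have := psi_ge y Ss; lra.
  suff : psi s.2 <= dot s.1 s.2 - p s by lra.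
  by apply: psi_le => s' Ss'; have := p_pot Ss Ss'; lra.
- move=> z z'; rewrite lerBlDr; apply: phi_le => y yr.
  by have := phi_ge z' yr; have := dot_lip z z' yr; lra.
- move=> y y'; rewrite lerBlDr; apply: psi_le => s Ss; have [x _] := S_cube Ss.
  by have := psi_ge y' Ss; have := dot_lip y y' x; rewrite !(dotC _ s.1); lra.
- move=> z h; rewrite -ler_pdivlMl//; apply: phi_le => y yr.
  have := phi_ge (z + h) yr; have := phi_ge (z - h) yr.
  by rewrite (dotBl z h) (dotDl z h); lra.
Qed.

End convex_conjugates.

Section optimal_swap.
Context (R : realType) (n : nat).
Local Notation E := 'rV[R]_n.
Context (alpha beta : set E -> \bar R) (gam : probability (E * E)%type R).
Hypothesis opt : optimal_coupling alpha beta gam.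
Hypothesis cost_fin : (transport_cost gam < +oo)%E.

Let c (z : E * E) : R := 2^-1 * eucl_dist z.1 z.2 ^+ 2.
Let c0 z : 0 <= c z. Proof. by rewrite mulr_ge0// sqr_ge0. Qed.
Let mc : measurable_fun setT (EFin \o c).
Proof. by apply/measurable_EFinP; apply: measurable_half_eucl_dist. Qed.

(** Cyclical monotonicity of an optimal plan at its atoms: moving a small mass [e]
    from each [s i] to the pair that keeps its second component and takes the first
    component of [s (sigma i)] preserves both marginals, so it cannot lower the
    cost. *)
Lemma optimal_swap N (s : 'I_N -> E * E) (sigma : 'I_N -> 'I_N) :
  injective sigma -> (forall i, (0 < gam [set s i])%E) ->
  \sum_i c (s i) <= \sum_i c ((s (sigma i)).1, (s i).2).
Proof.
move=> sigma_inj s_gt0.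
case: N => [|N] in s sigma sigma_inj s_gt0 *; first by rewrite !big_ord0.
pose s' i := ((s (sigma i)).1, (s i).2).
have ms i : measurable [set s i] by exact: measurable_rV2.
(* [N.+1] times [e], because the same atom may occur several times in [s] *)
have [e e0 es] : exists2 e : R, 0 < e & forall i, ((e * N.+1%:R)%:E <= gam [set s i])%E.
  pose e := \big[Num.min/1]_i (fine (gam [set s i]) / N.+1%:R).
  exists e.
    apply: (big_ind (fun x : R => 0 < x)) => // [x y x0 y0|i _]; first by rewrite lt_min x0.
    rewrite divr_gt0// fine_gt0// s_gt0/= ltey_eq; apply/orP; left.
    by rewrite fin_num_measure.
  move=> i; have /fineK <- : gam [set s i] \is a fin_num by rewrite fin_num_measure.
  by rewrite lee_fin -ler_pdivlMr//; exact: bigmin_le.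
have [M1 [M1E M1I]] := measure_lincomb (fun i => \d_(s i) : {measure set _ -> \bar R})
  (fun=> ltW e0).
have [M2 [M2E M2I]] := measure_lincomb (fun i => \d_(s' i) : {measure set _ -> \bar R})
  (fun=> ltW e0).
have M1le A : measurable A -> (M1 A <= gam A)%E.
  move=> mA; rewrite M1E.
  have [[i sA]|nA] := pselect (exists i, A (s i)).
    apply: le_trans (_ : (gam [set s i] <= _)%E); last first.
      by apply: le_measure; rewrite ?inE// => _ ->.
    apply: le_trans (es i).
    rewrite (@le_trans _ _ (\sum_(j < N.+1) e%:E)%E)//.
      apply: lee_sum => j _; rewrite [X in (_ * X)%E]diracE; case: (_ \in _); rewrite ?mule1 ?mule0//.
      by rewrite lee_fin ltW.
    by rewrite sumEFin sumr_const card_ord mulr_natr.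
  rewrite big1// => j _; rewrite [X in (_ * X)%E]diracE memNset ?mule0// => sA.
  by apply: nA; exists j.
have [D DE] := measure_sub M1le.
have M1fin A : measurable A -> M1 A \is a fin_num.
  move=> mA; rewrite ge0_fin_numE// (le_lt_trans (M1le _ mA))//.
  by rewrite ltey_eq fin_num_measure.
pose G := measure_add D M2.
have GE A : measurable A -> (G A + M1 A = gam A + M2 A)%E.
  move=> mA; rewrite /G measure_addE DE// addeAC subeK//.
  exact: M1fin.
have marg A : measurable A -> M1 A = M2 A -> G A = gam A.
  by move=> mA M12; rewrite -[LHS](addeK _ (M1fin _ mA)) GE// -M12 addeK// M1fin.
have G1 : G setT = 1%E.
  rewrite marg ?probability_setT// M1E M2E.
  by apply: eq_bigr => i _; congr (_ * _)%E; rewrite [LHS]diracT [RHS]diracT.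
have [P PE] := probability_of_measure G1.
have cplP : is_coupling alpha beta P.
  have [[mar1 mar2] _] := opt; split=> A mA.
    rewrite -(mar1 _ mA); apply: etrans (PE _) _; apply: marg.
      by rewrite -[X in measurable X]setTI; exact: measurable_fst.
    rewrite M1E M2E (reindex_inj sigma_inj) /=.
    by apply: eq_bigr => i _; congr (_ * _)%E; rewrite [LHS]diracE [RHS]diracE.
  rewrite -(mar2 _ mA); apply: etrans (PE _) _; apply: marg.
    by rewrite -[X in measurable X]setTI; exact: measurable_snd.
  by rewrite M1E M2E; apply: eq_bigr => i _; congr (_ * _)%E; rewrite [LHS]diracE [RHS]diracE.
have := opt.2 P cplP.
have cost_swap : (transport_cost P + (\sum_i e * c (s i))%:E =
                  transport_cost gam + (\sum_i e * c (s' i))%:E)%E.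
  have dI (u : 'I_N.+1 -> E * E) :
    (\sum_i e%:E * \int[\d_(u i)]_z (c z)%:E)%E = (\sum_i e * c (u i))%:E.
    rewrite -sumEFin; apply: eq_bigr => i _.
    by rewrite integral_dirac// diracT mul1e EFinM.
  have cE0 z : (0 <= (c z)%:E)%E by rewrite lee_fin.
  rewrite -!dI -M1I// -M2I// /transport_cost -!ge0_integral_measure_add//;
    try by move=> z _; exact: (cE0 z).
  apply: eq_measure_integral => A mA _.
  apply: etrans (measure_addE _ _ _) _; apply/esym.
  apply: etrans (measure_addE _ _ _) _; rewrite -GE//.
  by congr (_ + _)%E; exact/esym/PE.
have gfin : transport_cost gam \is a fin_num.
  by rewrite ge0_fin_numE//; apply: integral_ge0 => z _; rewrite lee_fin; exact: c0.
move=> le_cost; rewrite -(ler_pM2l e0) !mulr_sumr -lee_fin.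
by rewrite -(leeD2lE _ _ gfin) -cost_swap leeD2r.
Qed.
End optimal_swap.

Section finitely_supported.
Context (R : realType) (n : nat) (r : R) (r0 : 0 <= r).
Local Notation E := 'rV[R]_n.
Context (alpha beta : set E -> \bar R) (gam : probability (E * E)%type R).
Hypothesis opt : optimal_coupling alpha beta gam.
Context (Z : seq (E * E)).
Hypothesis Z_cube : forall z, z \in Z -> cube r z.1 /\ cube r z.2.
Hypothesis gamZ : {ae gam, forall z, z \in Z}.

Let cost_fin : (transport_cost gam < +oo)%E.
Proof.
apply: (@le_lt_trans _ _ (2 * (n%:R * r ^+ 2))%:E); last by rewrite ltry.
apply: ge0_ae_bounded_integral => //.
- exact: measurable_half_eucl_dist.
- by move=> z; rewrite mulr_ge0// sqr_ge0.
- by rewrite !mulr_ge0// sqr_ge0.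
- move: gamZ; apply: filterS => z /Z_cube[? ?]; exact: half_eucl_dist_cube.
Qed.

Let S : set (E * E) := [set s | (0 < gam [set s])%E].

Let S_Z s : S s -> s \in Z.
Proof.
move=> Ss; apply/negPn/negP => sZ; move: Ss; rewrite /S /= lt0e => /andP[/eqP + _]; apply.
apply: measure_negligible; first exact: measurable_rV2.
by apply: negligibleS gamZ => _ -> /=; exact/negP.
Qed.

Let gamS : {ae gam, forall z, S z}.
Proof.
have : {ae gam, forall z, forall s, s \in Z -> ~ S s -> z <> s}.
  elim: Z => [|s Z' IH]; first exact: aeW.
  have hs : {ae gam, forall z, ~ S s -> z <> s}.
    have [Ss|nSs] := pselect (S s); first exact: aeW.
    exists [set s]; split => //; first exact: measurable_rV2.
      by apply/eqP; rewrite eq_le measure_ge0 andbT leNgt; exact/negP.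
    by move=> z /= /not_implyP[_ /contrapT].
  move: IH hs; apply: filterS2 => z h1 h2 t; rewrite inE => /predU1P[->//|]; exact: h1.
move: gamZ; apply: filterS2 => z zZ h; apply: contrapT => nS.
exact: h zZ nS erefl.
Qed.

(* applied to a cyclic shift, [optimal_swap] says that the increments of the scalar
   product sum to at most 0 along a cycle of atoms *)
Let cyc N (f : nat -> E * E) : (forall i, S (f i)) ->
  \sum_(i < N) (dot (f i.+1).1 (f i).2 - dot (f i).1 (f i).2)
  + (dot (f 0%N).1 (f N).2 - dot (f N).1 (f N).2) <= 0.
Proof.
move=> Sf; have ordS_inj : injective (@ordS N.+1) by exact: ordS_inj.
have := @optimal_swap R n alpha beta gam opt cost_fin N.+1 (fun i => f i) (@ordS _) ordS_inj (fun i => Sf i).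
under eq_bigr do rewrite half_eucl_distE.
under [leRHS]eq_bigr do rewrite half_eucl_distE /=.
rewrite !sumrB !big_split /=.
rewrite -(reindex_inj ordS_inj (P := xpredT) (F := fun i : 'I_N.+1 => 2^-1 * dot (f i).1 (f i).1)) /=.
rewrite lerD2l lerN2 -subr_le0 -sumrB big_ord_recr /= modnn => le0.
apply: le_trans le0; rewrite lerD2r -sumrB; apply: ler_sum => i _.
by rewrite modn_small// ltnS.
Qed.

Lemma finite_optimal_potentials : exists phi psi : E -> R,
  [/\ forall z y, cube r y -> dot z y <= phi z + psi y,
      {ae gam, forall s, phi s.1 + psi s.2 <= dot s.1 s.2},
      forall z z', phi z - phi z' <= r * dist1 z z',
      forall y y', psi y - psi y' <= r * dist1 y y' &
      forall z h, 2 * phi z <= phi (z + h) + phi (z - h)].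
Proof.
have [p pp] := @cyclic_potential R _ S (fun s s' => dot s'.1 s.2 - dot s.1 s.2) cyc.
have S0 : S !=set0.
  have [[s Ss]|nS] := pselect (S !=set0); first by exists s.
  have : gam setT = 0%E.
    apply: measure_negligible => //; apply: negligibleS gamS => z _ /= Sz.
    by apply: nS; exists z.
  by rewrite probability_setT => /eqP; rewrite onee_eq0.
have SC : S `<=` cube r `*` cube r by move=> s /S_Z /Z_cube.
have [phi [psi [h1 h2 h3 h4 h5]]] := convex_conjugates r0 S0 SC pp.
by exists phi, psi; split => //; move: gamS; apply: filterS => s; exact: h2.
Qed.

End finitely_supported.

(** * Second differences of a convex function *)

Lemma lebesgue_measure_shift (R : realType) (a : R) (A : set R) :
  measurable A -> lebesgue_measure ((fun x => x + a) @^-1` A) = lebesgue_measure A.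
Proof.
move=> mA.
have ms : measurable_fun setT ((fun x : R => x + a) : R -> measurableTypeR R).
  exact: measurable_funD.
suff : pushforward lebesgue_measure ((fun x => x + a) : R -> measurableTypeR R) A
  = lebesgue_measure A by [].
apply/esym/lebesgue_measure_unique => //= _ [[b c]] _ <-.
rewrite /pushforward (_ : _ @^-1` _ = `]b - a, c - a]%classic).
  by rewrite !lebesgue_measure_itv/= !lte_fin ltrD2r -!EFinB opprB addrA subrK.
by apply/seteqP; split=> x /=; rewrite !in_itv/= ltrBlDr lerBrDr.
Qed.

Section translation.
Context (R : realType).

Lemma lebesgue_rV_shift n (v : 'rV[R]_n) (A : set 'rV[R]_n) :
  measurable A -> lebesgue_rV n ((fun x => x + v) @^-1` A) = lebesgue_rV n A.
Proof.
elim: n v A => [|n IHn] v A mA.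
  congr (_ _); apply/seteqP; split=> x /=; by rewrite (thinmx0 (x + v)) (thinmx0 x).
have mcA : measurable (@rV_cons R n @^-1` A).
  by rewrite -[X in measurable X]setTI; exact: measurable_rV_cons.
set v' : 'rV[R]_n := \row_i v ord0 (lift ord0 i).
set g := lebesgue_rV n \o xsection (@rV_cons R n @^-1` A).
have mg : measurable_fun setT g by exact: measurable_fun_xsection.
transitivity (\int[@lebesgue_measure R]_a g (a + v ord0 ord0)%R)%E.
  apply: eq_integral => a _ /=; rewrite /g /= -(IHn v'); last exact: measurable_xsection.
  congr (_ _); apply/seteqP; split=> x;
    rewrite /xsection /= !inE /=;
    rewrite (_ : rV_cons (a, x) + v = rV_cons (a + v ord0 ord0, x + v'))//;
  apply/rowP => i; rewrite mxE; have [j ->|->] := unliftP ord0 i;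
    by rewrite ?rV_consS ?rV_cons0 ?mxE.
have ms : measurable_fun setT ((fun x : R => x + v ord0 ord0) : measurableTypeR R -> measurableTypeR R).
  exact: measurable_funD.
have := @ge0_integral_pushforward _ _ _ _ R _ ms (@lebesgue_measure R) setT g measurableT mg.
rewrite preimage_setT => <- //.
by apply: eq_measure_integral => B mB _; exact: lebesgue_measure_shift.
Qed.

Lemma ge0_integral_shift n (v : 'rV[R]_n) (D : set 'rV[R]_n) (f : 'rV[R]_n -> \bar R) :
  measurable D -> measurable_fun D f -> (forall x, (0 <= f x)%E) ->
  (\int[lebesgue_rV n]_(x in (fun x => (x + v)%R) @^-1` D) f (x + v)%R =
   \int[lebesgue_rV n]_(x in D) f x)%E.
Proof.
move=> mD mf f0.
have := @ge0_integral_pushforward _ _ _ _ R _ (measurable_fun_shift v) (lebesgue_rV n) D f mD mf.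
move=> <- //.
apply: eq_measure_integral => [|mB B mmB _]; first exact: measurable_fun_shift.
exact: (lebesgue_rV_shift v mmB).
Qed.

(** A translation moves only the points of [B] that it takes out of [B], so it
    changes the integral of a bounded function by at most their measure. *)
Lemma integral_shift_le n (e : 'rV[R]_n) (B : set 'rV[R]_n) (U : 'rV[R]_n -> R) (K : R) :
  measurable B -> measurable_fun setT U -> (forall x, 0 <= U x <= K) ->
  (\int[lebesgue_rV n]_(x in B) (U x)%:E <=
   \int[lebesgue_rV n]_(x in B) (U (x - e)%R)%:E +
     K%:E * lebesgue_rV n (B `&` [set x | ~ B (x + e)%R]))%E.
Proof.
move=> mB mU UK.
pose B' := (fun x => x + e) @^-1` B.
have mB' : measurable B'.
  by rewrite -[X in measurable X]setTI; exact: measurable_fun_shift.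
have mV D : measurable_fun D (EFin \o U).
  by apply/measurable_EFinP; apply: measurable_funS mU.
have U0 x : (0 <= (U x)%:E)%E by rewrite lee_fin; case/andP: (UK x).
have BE : B = (B `&` B') `|` (B `&` ~` B').
  by rewrite -setIUr setUv setIT.
rewrite [X in (\int[_]_(x in X) _ <= _)%E]BE ge0_integral_setU//=; last 3 first.
- exact: measurableI.
- by apply: measurableI => //; exact: measurableC.
- by rewrite disj_set2E; apply/eqP/seteqP; split=> // x [[_ ?] []].
apply: leeD.
  rewrite -(ge0_integral_shift e mB (f := fun x => (U (x - e))%:E))//.
    rewrite [leRHS](eq_integral (EFin \o U)) => [|x _]; last by rewrite /= addrK.
    apply: ge0_subset_integral => //; exact: measurableI.
  apply/measurable_EFinP/measurable_funTS.
  by apply: (measurableT_comp mU); exact: measurable_fun_shift.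
have mBB' : measurable (B `&` ~` B') by apply: measurableI => //; exact: measurableC.
rewrite -(integral_cst (lebesgue_rV n) mBB' K%:E).
apply: ge0_le_integral => //= x _.
by rewrite lee_fin; case/andP: (UK x).
Qed.

End translation.

Section second_difference.
Context (R : realType) (n : nat) (r : R) (r0 : 0 < r).
Context (phi : 'rV[R]_n -> R).
Hypothesis phi_lip : forall z z', phi z - phi z' <= r * dist1 z z'.
Hypothesis phi_cvx : forall z h, 2 * phi z <= phi (z + h) + phi (z - h).

Definition second_diff (h z : 'rV[R]_n) := phi (z + h) + phi (z - h) - 2 * phi z.

Let mphi : measurable_fun setT phi. Proof. exact: measurable_lip1 phi_lip. Qed.

Lemma second_diff_ge0 h z : 0 <= second_diff h z.
Proof. by rewrite subr_ge0. Qed.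

Lemma measurable_second_diff h : measurable_fun setT (second_diff h).
Proof.
apply: measurable_funB; last exact: measurable_funM.
by apply: measurable_funD; apply: (measurableT_comp mphi); exact: measurable_fun_shift.
Qed.

Lemma lebesgue_cube : lebesgue_rV n (cube r) = ((2 * r) ^+ n)%:E.
Proof.
rewrite cubeE (@lebesgue_rV_box R n (fun=> `[- r, r]%classic)); last first.
  by move=> j; exact: measurable_itv.
rewrite (eq_bigr (fun=> (2 * r)%:E)); last first.
  move=> j _; rewrite lebesgue_measure_itv/= lte_fin.
  by rewrite ifT ?gtrN// -EFinB opprK mulr2n mulrDl !mul1r.
by rewrite prodEFin prodr_const card_ord.
Qed.

(** The points of the cube that a translation along the [i]-th axis takes out of it
    lie in a slab of thickness [t]. *)
Lemma cube_exit (i : 'I_n) (t : R) (x : 'rV[R]_n) : 0 <= t ->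
  cube r x -> ~ cube r (x + t *: delta_mx ord0 i) -> r - t < x ord0 i.
Proof.
move=> t0 xr; apply: contra_notT; rewrite -leNgt => xi j.
rewrite !mxE eqxx /=; case: eqP => [->|_]; last by rewrite mulr0 addr0; exact: xr.
by have := xr i; rewrite mulr1 !ler_norml => /andP[? ?]; apply/andP; split; lra.
Qed.

Lemma lebesgue_cube_exit (i : 'I_n) (t : R) : 0 <= t ->
  (lebesgue_rV n (cube r `&` [set x | ~ cube r (x + t *: delta_mx ord0 i)%R]) <=
   (t * (2 * r) ^+ n.-1)%:E)%E.
Proof.
move=> t0.
pose A (j : 'I_n) : set R := if j == i then `](r - t), r]%classic else `[- r, r]%classic.
have mA j : measurable (A j) by rewrite /A; case: ifP.
have mS := measurable_rV_box mA.
apply: (@le_trans _ _ (lebesgue_rV n [set x | forall j, A j (x ord0 j)])).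
  apply: le_measure; rewrite ?inE.
  - apply: measurableI; first exact: measurable_cube.
    apply: measurableC; rewrite -[X in measurable X]setTI.
    by apply: measurable_fun_shift => //; exact: measurable_cube.
  - exact: mS.
  - move=> x [xr nx] j; have := xr j; rewrite ler_norml => /andP[x1 x2].
    rewrite /A; case: eqP => [->|_]; rewrite /= in_itv/= ?x1 ?x2//.
    rewrite (cube_exit t0 xr nx)/=.
    by have := xr i; rewrite ler_norml => /andP[].
rewrite lebesgue_rV_box// (bigD1 i)//= {1}/A eqxx lebesgue_measure_itv/= lte_fin.
rewrite (eq_bigr (fun=> (2 * r)%:E)); last first.
  move=> j /negbTE ji; rewrite /A ji lebesgue_measure_itv/= lte_fin.
  by rewrite ifT ?gtrN// -EFinB opprK mulr2n mulrDl !mul1r.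
rewrite prodEFin prodr_const.
rewrite (_ : #|_| = n.-1); last by rewrite cardC1 card_ord.
case: ifPn => _; first by rewrite -EFinB -EFinM opprB addrC subrK.
by rewrite mul0e lee_fin mulr_ge0// exprn_ge0// mulr_ge0// ltW.
Qed.

(** The distributional second derivatives of a convex Lipschitz function are
    measures of finite mass, so its second differences at step [t] have integral of
    order [t ^+ 2]. The bound comes from writing the second difference as
    [U x - U (x - e)] with [U] a first difference, which telescopes up to the slab
    that leaves the cube. *)
Lemma integral_second_diff (i : 'I_n) (t : R) : 0 <= t ->
  (\int[lebesgue_rV n]_(x in cube r) (second_diff (t *: delta_mx ord0 i) x)%:E <=
   (2 * r * t * (t * (2 * r) ^+ n.-1))%:E)%E.
Proof.
move=> t0; set e : 'rV[R]_n := t *: delta_mx ord0 i.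
have ze z : dist1 (z + e) z = t.
  rewrite /dist1 (bigD1 i)//= big1 => [|j ji].
    by rewrite !mxE !eqxx mulr1 addrAC subrr add0r addr0 ger0_norm.
  by rewrite !mxE (negbTE ji) mulr0 addr0 subrr normr0.
(* the constant [r * t] makes [U] nonnegative *)
pose U (x : 'rV[R]_n) := phi (x + e) - phi x + r * t.
have UK (x : 'rV[R]_n) : 0 <= U x <= 2 * r * t.
  have := phi_lip (x + e) x; have := phi_lip x (x + e).
  by rewrite dist1C ze /U => ? ?; apply/andP; split; lra.
have mU : measurable_fun setT U.
  apply: measurable_funD => //; apply: measurable_funB => //.
  by apply: (measurableT_comp mphi); exact: measurable_fun_shift.
have mC := @measurable_cube R n r.
have := integral_shift_le e mC mU UK.
have UE (x : 'rV[R]_n) : U x = second_diff e x + U (x - e).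
  by rewrite /U /second_diff subrK; lra.
have mUe : measurable_fun setT (fun x : 'rV[R]_n => U (x - e)).
  by apply: (measurableT_comp mU); exact: measurable_fun_shift.
have -> : (\int[lebesgue_rV n]_(x in cube r) (U x)%:E =
   \int[lebesgue_rV n]_(x in cube r) (second_diff e x)%:E +
   \int[lebesgue_rV n]_(x in cube r) (U (x - e)%R)%:E)%E.
  under eq_integral do rewrite UE EFinD.
  apply: ge0_integralD => //.
  - by move=> x _; rewrite lee_fin second_diff_ge0.
  - apply/measurable_EFinP/measurable_funTS; exact: measurable_second_diff.
  - by move=> x _; rewrite lee_fin; case/andP: (UK (x - e)).
  - exact/measurable_EFinP/measurable_funTS.
have fin : (\int[lebesgue_rV n]_(x in cube r) (U (x - e)%R)%:E)%E \is a fin_num.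
  rewrite ge0_fin_numE; last first.
    by apply: integral_ge0 => x _; rewrite lee_fin; case/andP: (UK (x - e)).
  apply: (@le_lt_trans _ _ (\int[lebesgue_rV n]_(x in cube r) (2 * r * t)%:E)%E).
    apply: ge0_le_integral => //.
    - by move=> x _; rewrite lee_fin; case/andP: (UK (x - e)).
    - exact/measurable_EFinP/measurable_funTS.
    - by move=> x _; rewrite lee_fin; case/andP: (UK (x - e)).
  by rewrite integral_cst// [X in (_ * X)%E]lebesgue_cube -EFinM ltry.
rewrite [X in (_ <= X)%E]addeC (leeD2rE _ _ fin) => /le_trans; apply.
rewrite [leRHS]EFinM; apply: lee_wpmul2l; last exact: lebesgue_cube_exit.
by rewrite lee_fin !mulr_ge0// ltW.
Qed.

End second_difference.

Lemma density_integral_le (R : realType) n (mu : probability 'rV[R]_n R) (M : R)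
    (B : set 'rV[R]_n) (f : 'rV[R]_n -> R) :
  has_density_bounded_by mu M -> 0 <= M -> measurable B -> {ae mu, forall x, B x} ->
  measurable_fun setT f -> (forall x, 0 <= f x) ->
  (\int[mu]_x (f x)%:E <= M%:E * \int[lebesgue_rV n]_(x in B) (f x)%:E)%E.
Proof.
move=> [g [mg gM muE]] M0 mB muB mf f0.
have muBC : mu (~` B) = 0%E.
  by apply: measure_negligible => //; exact: measurableC.
have mEf D : measurable_fun D (EFin \o f) by exact/measurable_EFinP/measurable_funTS.
rewrite (ge0_negligible_integral (measurableC mB))//; last first.
  by move=> x _; rewrite lee_fin.
rewrite setTD setCK.
rewrite -(ge0_integral_mscale _ mB (NngNum M0))//; last first.
  by move=> x _; rewrite lee_fin.
have ef0 x : (0 <= (EFin \o f) x)%E by rewrite lee_fin.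
apply: (ge0_le_measure_integral _ mB ef0 (mEf setT)) => A mA.
rewrite [leLHS]muE// [leRHS](_ : _ = \int[lebesgue_rV n]_(x in A) (cst M%:E) x)%E; last first.
  by rewrite integral_cst.
apply: ge0_le_integral => //.
- by move=> x _; rewrite lee_fin; case/andP: (gM x).
- exact/measurable_EFinP/measurable_funTS.
- by move=> x _; rewrite lee_fin; case/andP: (gM x).
Qed.

(** * Stability of optimal plans *)

Section subgradient_gap.
Context (R : realType) (n : nat) (r : R).
Context (phi psi : 'rV[R]_n -> R).
Hypothesis young : forall z y, cube r y -> dot z y <= phi z + psi y.
Hypothesis phi_lip : forall z z', phi z - phi z' <= r * dist1 z z'.
Hypothesis psi_lip : forall y y', psi y - psi y' <= r * dist1 y y'.

(** The defect in the Young inequality; [y] is a [gap x y]-subgradient of [phi] at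
    [x]. *)
Definition gap x y := phi x + psi y - dot x y.

Lemma gap_lip x y x' y' : cube r x -> cube r y' ->
  gap x y <= gap x' y' + 2 * r * dist1 x x' + 2 * r * dist1 y y'.
Proof.
move=> xr yr; have := phi_lip x x'; have := psi_lip y y'.
have := dot_lip x' x yr; have := dot_lip y' y xr.
by rewrite (dotC y') (dotC y) (dist1C x') (dist1C y') /gap; lra.
Qed.

Lemma dot_delta (t : R) i (x y : 'rV[R]_n) :
  dot (x + t *: delta_mx ord0 i) y = dot x y + t * y ord0 i.
Proof.
rewrite dotDl; congr (_ + _); rewrite /dot (bigD1 i)//= big1 ?addr0 => [|j ji].
  by rewrite !mxE !eqxx mulr1.
by rewrite !mxE (negbTE ji) mulr0 mul0r.
Qed.

(** Two approximate subgradients at the same point differ, in each coordinate, by at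
    most the slope increment of [phi] over a step [t], plus their defects divided by
    [t]. *)
Lemma subgradient_gap (t : R) x y y' : 0 <= t -> cube r y -> cube r y' ->
  t * dist1 y y' <=
  \sum_(i < n) second_diff phi (t *: delta_mx ord0 i) x + n%:R * (gap x y + gap x y').
Proof.
move=> t0 yr yr'.
have -> : n%:R * (gap x y + gap x y') = \sum_(i < n) (gap x y + gap x y').
  by rewrite sumr_const card_ord mulr_natl.
rewrite -big_split mulr_sumr; apply: ler_sum => i _ /=.
have key u v : cube r u -> cube r v ->
    t * (u ord0 i - v ord0 i) <=
    second_diff phi (t *: delta_mx ord0 i) x + (gap x u + gap x v).
  move=> ur vr; have := young (x + t *: delta_mx ord0 i) ur.
  have := young (x - t *: delta_mx ord0 i) vr.
  by rewrite -scaleNr !dot_delta /second_diff /gap -scaleNr; lra.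
rewrite -(ger0_norm t0) -normrM ler_norml ger0_norm// (key _ _ yr yr') andbT.
by rewrite lerNl -mulrN opprB [gap x y + _]addrC (key _ _ yr' yr).
Qed.

(** The potential of the first marginal cancels between the defects at (x1, y1) and
    (x1, y2), which leaves a difference of costs and of potentials of the second
    marginal. *)
Lemma gap_comparison (t : R) x1 y1 xh yh y2 : 0 <= t ->
  cube r x1 -> cube r y1 -> cube r yh -> cube r y2 -> gap xh yh <= 0 ->
  t * dist1 y1 yh <=
  \sum_(i < n) second_diff phi (t *: delta_mx ord0 i) x1 +
  n%:R * ((2^-1 * eucl_dist x1 y1 ^+ 2 - (2^-1 * dot y1 y1 - psi y1)) -
          (2^-1 * eucl_dist x1 y2 ^+ 2 - (2^-1 * dot y2 y2 - psi y2))) +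
  (4 * r * n%:R * dist1 x1 xh + 2 * r * n%:R * dist1 yh y2).
Proof.
move=> t0 xr yr1 hr yr2 contact.
have h1 := subgradient_gap x1 t0 yr1 hr.
have h2 := gap_lip yh xh xr hr; have h3 := gap_lip y2 xh xr hr.
have dyy : dist1 yh yh = 0 by rewrite /dist1 big1// => i _; rewrite subrr normr0.
have e1 : gap x1 y1 - gap x1 y2 =
    (2^-1 * eucl_dist x1 y1 ^+ 2 - (2^-1 * dot y1 y1 - psi y1)) -
    (2^-1 * eucl_dist x1 y2 ^+ 2 - (2^-1 * dot y2 y2 - psi y2)).
  by rewrite !half_eucl_distE /gap; lra.
have h4 : gap x1 y1 + gap x1 yh <=
    (2^-1 * eucl_dist x1 y1 ^+ 2 - (2^-1 * dot y1 y1 - psi y1)) -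
    (2^-1 * eucl_dist x1 y2 ^+ 2 - (2^-1 * dot y2 y2 - psi y2)) +
    4 * r * dist1 x1 xh + 2 * r * dist1 yh y2.
  by rewrite -e1; rewrite dyy mulr0 in h2; rewrite (dist1C yh); lra.
by have := ler_wpM2l (ler0n R n) h4; lra.
Qed.

End subgradient_gap.

Section stability.
Context (R : realType) (n : nat) (r M : R) (r0 : 0 < r) (M0 : 0 <= M).
Local Notation E := 'rV[R]_n.
Local Notation Z := (E * E)%type.
Context (mu nu : probability E R) (alpha beta : set E -> \bar R).
Context (gam ghat : probability Z R).
Hypothesis mu_density : has_density_bounded_by mu M.
Hypothesis mu_cube : {ae mu, forall x, cube r x}.
Hypothesis nu_cube : {ae nu, forall y, cube r y}.
Hypothesis gam_opt : optimal_coupling mu nu gam.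
Hypothesis ghat_opt : optimal_coupling alpha beta ghat.
Context (supp : seq Z).
Hypothesis supp_cube : forall z, z \in supp -> cube r z.1 /\ cube r z.2.
Hypothesis ghat_supp : {ae ghat, forall z, z \in supp}.
Context (F1 F2 : finType) (q1 : E -> F1) (q2 : E -> F2) (eta1 eta2 : R).
Hypothesis mq1 : forall k, measurable (q1 @^-1` [set k]).
Hypothesis mq2 : forall k, measurable (q2 @^-1` [set k]).
Hypothesis q1_diam : forall x x', cube r x -> cube r x' -> q1 x = q1 x' ->
  dist1 x x' <= eta1.
Hypothesis q2_diam : forall x x', cube r x -> cube r x' -> q2 x = q2 x' ->
  dist1 x x' <= eta2.

Let Om : Type := (Z * Z * Z)%type.

Let mfst_pre (A : set E) : measurable A -> measurable (@fst E E @^-1` A).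
Proof. exact: (measurable_preT measurable_fst). Qed.

Let msnd_pre (A : set E) : measurable A -> measurable (@snd E E @^-1` A).
Proof. exact: (measurable_preT measurable_snd). Qed.

Let pre_fst (T1 T2 : Type) (A : set T1) : @fst T1 T2 @^-1` A = A `*` setT.
Proof. by apply/seteqP; split=> [z Az|z []]. Qed.

Let pre_snd (T1 T2 : Type) (A : set T2) : @snd T1 T2 @^-1` A = setT `*` A.
Proof. by apply/seteqP; split=> [z Az|z []]. Qed.

(* a point of [Om] is ((x1, y1), (xh, yh), (x2, y2)) with (x1, y1) and (x2, y2)
   distributed as [gam], (xh, yh) distributed as [ghat], xh mostly in the cell of x1
   and yh mostly in the cell of y2 *)
Let three_point_coupling : exists (Pi : probability (Z * Z)%type R)
    (Th : probability (Z * Z * Z)%type R),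
  [/\ is_coupling gam ghat Pi,
      is_coupling Pi gam Th,
      (Th [set w | q1 w.1.1.1 != q1 w.1.2.1] <= (label_gap q1 mu alpha)%:E)%E &
      (Th [set w | q2 w.1.2.2 != q2 w.2.2] <= (label_gap q2 beta nu)%:E)%E].
Proof.
have [gamC _] := gam_opt; have [ghatC _] := ghat_opt.
have [Pi [Pi1 Pi2 Pi3]] := @label_coupling _ _ Z Z R gam ghat F1
  (q1 \o fst) (q1 \o fst) (fun k => mfst_pre (mq1 k)) (fun k => mfst_pre (mq1 k)).
have mPi2 k : measurable ((q2 \o snd \o (@snd Z Z)) @^-1` [set k]).
  exact: measurable_preT (@measurable_snd _ _ Z Z) (msnd_pre (mq2 k)).
have [Th [Th1 Th2 Th3]] := @label_coupling _ _ (Z * Z)%type Z R Pi gam F2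
  (q2 \o snd \o snd) (q2 \o snd) mPi2 (fun k => msnd_pre (mq2 k)).
have PiC : is_coupling gam ghat Pi.
  by split=> A mA; rewrite /pushforward ?pre_fst ?pre_snd; [exact: Pi1|exact: Pi2].
exists Pi, Th; split => //.
- by split=> A mA; rewrite /pushforward ?pre_fst ?pre_snd; [exact: Th1|exact: Th2].
- have -> : [set w : Z * Z * Z | q1 w.1.1.1 != q1 w.1.2.1] =
            [set z : Z * Z | q1 z.1.1 != q1 z.2.1] `*` setT.
    by apply/seteqP; split=> [w //|w []].
  rewrite Th1; last first.
    by apply: measurable_label_neq => k;
      [exact: measurable_preT (@measurable_fst _ _ Z Z) (mfst_pre (mq1 k))
      |exact: measurable_preT (@measurable_snd _ _ Z Z) (mfst_pre (mq1 k))].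
  apply: le_trans Pi3 _; rewrite lee_fin /label_gap le_eqVlt; apply/orP; left; apply/eqP.
  by apply: eq_bigr => k _; rewrite -(gamC.1 _ (mq1 k)) -(ghatC.1 _ (mq1 k)).
- apply: le_trans (_ : (Th [set z | (q2 \o snd \o snd) z.1 != (q2 \o snd) z.2] <= _)%E) => //.
  apply: le_trans Th3 _; rewrite lee_fin /label_gap le_eqVlt; apply/orP; left; apply/eqP.
  apply: eq_bigr => k _; congr (`|fine _ - fine _|); last exact: gamC.2.
  rewrite -(ghatC.2 _ (mq2 k)); exact: (PiC.2 _ (msnd_pre (mq2 k))).
Qed.


Let ge0_integralD_EFin (P : probability Om R) (f g : Om -> R) :
  measurable_fun setT f -> measurable_fun setT g ->
  (forall w, 0 <= f w) -> (forall w, 0 <= g w) ->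
  (\int[P]_w (f w + g w)%:E = \int[P]_w (f w)%:E + \int[P]_w (g w)%:E)%E.
Proof.
move=> mf mg f0 g0; under eq_integral do rewrite EFinD.
by apply: ge0_integralD => //; [move=> w _; rewrite lee_fin| exact/measurable_EFinP
  | move=> w _; rewrite lee_fin | exact/measurable_EFinP].
Qed.

Let ge0_integralZl_fin (P : probability Om R) (k : R) (f : Om -> R) :
  measurable_fun setT f -> (forall w, 0 <= f w) -> 0 <= k ->
  (\int[P]_w (k * f w)%:E = k%:E * \int[P]_w (f w)%:E)%E.
Proof.
move=> mf f0 k0; under eq_integral do rewrite EFinM.
apply: ge0_integralZl_EFin => //; last exact/measurable_EFinP.
by move=> w _; rewrite lee_fin.
Qed.

Let label_dist (P : probability Om R) (F : finType) (q : E -> F) (eta g : R)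
    (f h : Om -> E) : 0 <= eta ->
  measurable_fun setT f -> measurable_fun setT h ->
  (forall k, measurable (q @^-1` [set k])) ->
  (forall x x', cube r x -> cube r x' -> q x = q x' -> dist1 x x' <= eta) ->
  {ae P, forall w, cube r (f w)} -> {ae P, forall w, cube r (h w)} ->
  (P [set w | q (f w) != q (h w)] <= g%:E)%E ->
  (\int[P]_w (dist1 (f w) (h w))%:E <= (eta + n%:R * (2 * r) * g)%:E)%E.
Proof.
move=> eta0 mf mh mq diam fr hr Pg.
pose N : set Om := [set w | q (f w) != q (h w)].
have mN : measurable N.
  by apply: measurable_label_neq => k; exact: measurable_preT.
have nr0 : 0 <= n%:R * (2 * r) by rewrite !mulr_ge0// ltW.
have dist_le w : cube r (f w) -> cube r (h w) -> dist1 (f w) (h w) <= n%:R * (2 * r).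
  exact: dist1_cube.
move: (n%:R * (2 * r)) nr0 dist_le => c c0 dist_le.
have mi : measurable_fun setT (\1_N : Om -> R) by exact: measurable_indic.
apply: (@le_trans _ _ (\int[P]_w (eta + c * \1_N w)%:E)%E).
  apply: ae_ge0_le_integral => //.
  - by move=> w _; rewrite lee_fin dist1_ge0.
  - exact/measurable_EFinP/measurable_dist1.
  - by move=> w _; rewrite lee_fin addr_ge0// mulr_ge0.
  - by apply/measurable_EFinP; apply: measurable_funD => //; exact: measurable_funM.
  - move: fr hr; apply: filterS2 => w fw hw _; rewrite lee_fin indicE.
    have [wN|wN] := boolP (w \in N).
      by rewrite mulr1 (le_trans (dist_le _ fw hw))// lerDr.
    rewrite mulr0 addr0; apply: diam => //; apply/eqP/negPn.
    by move: wN; rewrite notin_setE => /negP.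
rewrite ge0_integral_affine// integral_indic// setIT EFinD EFinM.
by apply: leeD => //; exact: lee_wpmul2l.
Qed.

Hypotheses (eta1_ge0 : 0 <= eta1) (eta2_ge0 : 0 <= eta2).

Let d1 := eta1 + n%:R * (2 * r) * label_gap q1 mu alpha.
Let d2 := eta2 + n%:R * (2 * r) * label_gap q2 beta nu.

(** Let [phi], [psi] be potentials of [ghat]. Under the three-point coupling the law of
    (x1, y2) couples [mu] and [nu], and its Young defect is small because (x1, y2) is
    close to (xh, yh), where the defect vanishes. As [gam] costs less and the
    potentials integrate to the same values, (x1, y1) has small defect in mean; so
    does (x1, yh). Hence y1 and yh are close by [subgradient_gap], where the second
    differences are small because [mu] has bounded density. *)
Lemma coupling_stability (t : R) : 0 < t ->
  exists Pi : probability (Z * Z)%type R, is_coupling gam ghat Pi /\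
  (\int[Pi]_z (eucl_dist_prod z.1 z.2 ^+ 2)%:E <=
   (2 * r * (d1 + (n%:R * (M * (2 * r * t * (t * (2 * r) ^+ n.-1))) +
                   (4 * r * n%:R * d1 + 2 * r * n%:R * d2)) / t))%:E)%E.
Proof.
move=> t0; have [Pi [Th [PiC ThC Th1 Th2]]] := three_point_coupling.
have [phi [psi [young contact phi_lip psi_lip phi_cvx]]] :=
  finite_optimal_potentials (ltW r0) ghat_opt supp_cube ghat_supp.
have [gamC gam_min] := gam_opt.
have r0' := ltW r0.
have mx1 : measurable_fun setT (fun w : Om => w.1.1.1).
  exact: (measurableT_comp measurable_fst (measurableT_comp measurable_fst measurable_fst)).
have my1 : measurable_fun setT (fun w : Om => w.1.1.2).
  exact: (measurableT_comp measurable_snd (measurableT_comp measurable_fst measurable_fst)).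
have mxh : measurable_fun setT (fun w : Om => w.1.2.1).
  exact: (measurableT_comp measurable_fst (measurableT_comp measurable_snd measurable_fst)).
have myh : measurable_fun setT (fun w : Om => w.1.2.2).
  exact: (measurableT_comp measurable_snd (measurableT_comp measurable_snd measurable_fst)).
have my2 : measurable_fun setT (fun w : Om => w.2.2).
  exact: (measurableT_comp measurable_snd measurable_snd).
have law11 A : measurable A -> Th ((fun w : Om => w.1.1) @^-1` A) = gam A.
  move=> mA; rewrite -(PiC.1 _ mA); apply: (ThC.1).
  exact: measurable_preT (@measurable_fst _ _ Z Z) mA.
have law12 A : measurable A -> Th ((fun w : Om => w.1.2) @^-1` A) = ghat A.
  move=> mA; rewrite -(PiC.2 _ mA); apply: (ThC.1).
  exact: measurable_preT (@measurable_snd _ _ Z Z) mA.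
have law2 A : measurable A -> Th ((fun w : Om => w.2) @^-1` A) = gam A := ThC.2 A.
have lx1 A : measurable A -> Th ((fun w : Om => w.1.1.1) @^-1` A) = mu A.
  by move=> mA; rewrite -(gamC.1 _ mA); apply: law11; exact: mfst_pre.
have ly1 A : measurable A -> Th ((fun w : Om => w.1.1.2) @^-1` A) = nu A.
  by move=> mA; rewrite -(gamC.2 _ mA); apply: law11; exact: msnd_pre.
have ly2 A : measurable A -> Th ((fun w : Om => w.2.2) @^-1` A) = nu A.
  by move=> mA; rewrite -(gamC.2 _ mA); apply: law2; exact: msnd_pre.
have m12 : measurable_fun setT (fun w : Om => w.1.2).
  exact: (measurableT_comp measurable_snd measurable_fst).
have x1r : {ae Th, forall w, cube r w.1.1.1} by exact: (ae_law mx1 lx1).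
have y1r : {ae Th, forall w, cube r w.1.1.2} by exact: (ae_law my1 ly1).
have y2r : {ae Th, forall w, cube r w.2.2} by exact: (ae_law my2 ly2).
have supp_h : {ae Th, forall w, w.1.2 \in supp} by exact: (ae_law m12 law12 ghat_supp).
have contact_h : {ae Th, forall w, phi w.1.2.1 + psi w.1.2.2 <= dot w.1.2.1 w.1.2.2}.
  exact: (ae_law m12 law12 contact).
have xhr : {ae Th, forall w, cube r w.1.2.1}.
  by move: supp_h; apply: filterS => w /supp_cube[].
have yhr : {ae Th, forall w, cube r w.1.2.2}.
  by move: supp_h; apply: filterS => w /supp_cube[].
have ID1 : (\int[Th]_w (dist1 w.1.1.1 w.1.2.1)%:E <= d1%:E)%E.
  exact: (label_dist eta1_ge0 mx1 mxh mq1 q1_diam x1r xhr Th1).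
have ID2 : (\int[Th]_w (dist1 w.1.2.2 w.2.2)%:E <= d2%:E)%E.
  exact: (label_dist eta2_ge0 myh my2 mq2 q2_diam yhr y2r Th2).
pose c (x y : E) := 2^-1 * eucl_dist x y ^+ 2.
have c0 x y : 0 <= c x y by rewrite mulr_ge0// sqr_ge0.
pose K := r * (n%:R * (2 * r)); pose C0 := `|psi 0| + K.
(* the dual potential of the second marginal, shifted to be nonnegative on the cube *)
pose v y := `|2^-1 * dot y y - psi y + C0|.
have v0 y : 0 <= v y by exact: normr_ge0.
have cube0 : cube r (0 : E) by move=> i; rewrite mxE normr0.
have vE y : cube r y -> v y = 2^-1 * dot y y - psi y + C0.
  move=> yr; rewrite /v ger0_norm//.
  have : 0 <= dot y y by apply: sumr_ge0 => i _; rewrite -expr2 sqr_ge0.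
  have := psi_lip y 0; have : r * dist1 y 0 <= K by rewrite ler_wpM2l//; exact: dist1_cube.
  by have := ler_norm (psi 0); rewrite /C0; lra.
have v_le y : cube r y -> v y <= n%:R * r ^+ 2 + 2 * C0.
  move=> yr; rewrite vE//.
  have := psi_lip 0 y; have : r * dist1 0 y <= K by rewrite ler_wpM2l//; exact: dist1_cube.
  have := dot_cube r0' yr yr; rewrite ler_norml => /andP[_].
  have : 0 <= n%:R * r ^+ 2 by rewrite mulr_ge0// sqr_ge0.
  by have := ler_norm (- psi 0); rewrite normrN /C0; lra.
have mpsi : measurable_fun setT psi by exact: measurable_lip1 psi_lip.
have mv : measurable_fun setT v.
  apply: measurableT_comp => //; apply: measurable_funD => //.
  apply: measurable_funB => //; apply: measurable_funM => //.
  exact: measurable_dot.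
have K0 : 0 <= K by rewrite !mulr_ge0.
have C0_ge0 : 0 <= C0 by rewrite addr_ge0.
(* every integral below is that of an almost everywhere bounded function *)
have finI (f : Om -> R) B : measurable_fun setT f -> (forall w, 0 <= f w) -> 0 <= B ->
    {ae Th, forall w, f w <= B} -> exists2 a, 0 <= a & (\int[Th]_w (f w)%:E = a%:E)%E.
  move=> mf f0 B0 fB.
  have I0 : (0 <= \int[Th]_w (f w)%:E)%E.
    by apply: integral_ge0 => w _; rewrite lee_fin.
  have Ifin : (\int[Th]_w (f w)%:E)%E \is a fin_num.
    rewrite ge0_fin_numE//; apply: le_lt_trans (ge0_ae_bounded_integral mf f0 B0 fB) _.
    by rewrite ltry.
  by exists (fine (\int[Th]_w (f w)%:E)%E); rewrite ?fine_ge0// fineK.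
have ae1 (A B : Om -> Prop) : (forall w, A w -> B w) ->
    {ae Th, forall w, A w} -> {ae Th, forall w, B w}.
  by move=> h; apply: filterS.
have ae2 (A B C : Om -> Prop) : (forall w, A w -> B w -> C w) ->
    {ae Th, forall w, A w} -> {ae Th, forall w, B w} -> {ae Th, forall w, C w}.
  by move=> h; apply: filterS2.
have nr20 : 0 <= 2 * (n%:R * r ^+ 2) by rewrite !mulr_ge0// sqr_ge0.
have mc11 : measurable_fun setT (fun w : Om => c w.1.1.1 w.1.1.2).
  exact: measurable_half_eucl_dist.
have mc12 : measurable_fun setT (fun w : Om => c w.1.1.1 w.2.2).
  exact: measurable_half_eucl_dist.
have mv1 : measurable_fun setT (fun w : Om => v w.1.1.2) by exact: measurableT_comp.
have mv2 : measurable_fun setT (fun w : Om => v w.2.2) by exact: measurableT_comp.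
have mD : measurable_fun setT (fun w : Om => dist1 w.1.1.2 w.1.2.2).
  exact: measurable_dist1.
have mD1 : measurable_fun setT (fun w : Om => dist1 w.1.1.1 w.1.2.1).
  exact: measurable_dist1.
have mD2 : measurable_fun setT (fun w : Om => dist1 w.1.2.2 w.2.2).
  exact: measurable_dist1.
have nr0 : 0 <= n%:R * (2 * r) by rewrite !mulr_ge0.
have [a11 a11_ge0 a11E] := finI _ _ mc11 (fun w => c0 _ _) nr20
  (ae2 _ _ _ (fun w h h' => half_eucl_dist_cube r0' h h') x1r y1r).
have [a12 a12_ge0 a12E] := finI _ _ mc12 (fun w => c0 _ _) nr20
  (ae2 _ _ _ (fun w h h' => half_eucl_dist_cube r0' h h') x1r y2r).
have vB0 : 0 <= n%:R * r ^+ 2 + 2 * C0 by rewrite addr_ge0 ?mulr_ge0// sqr_ge0.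
have [b1 b1_ge0 b1E] := finI _ _ mv1 (fun w => v0 _) vB0 (ae1 _ _ (fun w => @v_le _) y1r).
have [b2 b2_ge0 b2E] := finI _ _ mv2 (fun w => v0 _) vB0 (ae1 _ _ (fun w => @v_le _) y2r).
have [aD aD_ge0 aDE] := finI _ _ mD (fun w => dist1_ge0 _ _) nr0
  (ae2 _ _ _ (fun w h h' => dist1_cube h h') y1r yhr).
have [aD1 aD1_ge0 aD1E] := finI _ _ mD1 (fun w => dist1_ge0 _ _) nr0
  (ae2 _ _ _ (fun w h h' => dist1_cube h h') x1r xhr).
have [aD2 aD2_ge0 aD2E] := finI _ _ mD2 (fun w => dist1_ge0 _ _) nr0
  (ae2 _ _ _ (fun w h h' => dist1_cube h h') yhr y2r).
have b12 : b1 = b2.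
  apply: EFin_inj; rewrite -b1E -b2E.
  by rewrite (ge0_integral_law my1 ly1 mv)// (ge0_integral_law my2 ly2 mv).
(* the law of (x1, y2) couples mu and nu, so gam cannot cost more *)
have a1112 : a11 <= a12.
  have mg : measurable_fun setT (fun w : Om => (w.1.1.1, w.2.2)).
    by apply/measurable_fun_pairP; split.
  have push1 : pushforward Th (fun w : Om => (w.1.1.1, w.2.2)) setT = 1%E.
    by rewrite /pushforward preimage_setT probability_setT.
  have [Q QE] := @probability_of_measure _ _ R
    (pushforward Th (fun w : Om => (w.1.1.1, w.2.2))) push1.
  have QC : is_coupling mu nu Q.
    split=> A mA; first by rewrite -(lx1 _ mA); exact: QE.
    by rewrite -(ly2 _ mA); exact: QE.
  have := gam_min Q QC; rewrite /transport_cost.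
  have mc : measurable_fun setT (fun z : Z => c z.1 z.2).
    exact: measurable_half_eucl_dist.
  have m11 : measurable_fun setT (fun w : Om => w.1.1).
    exact: (measurableT_comp measurable_fst measurable_fst).
  rewrite -(ge0_integral_law m11 law11 mc)// a11E.
  rewrite -(ge0_integral_law (m := Th) mg (m' := Q) _ mc)//; last by move=> A _; exact/esym/QE.
  by rewrite a12E lee_fin.
pose s x := \sum_(i < n) second_diff phi (t *: delta_mx ord0 i) x.
have sd0 i x : 0 <= second_diff phi (t *: delta_mx ord0 i) x by exact: second_diff_ge0.
have msd i := measurable_second_diff phi_lip (t *: delta_mx ord0 i).
have s_ge0 x : 0 <= s x by apply: sumr_ge0.
have ms : measurable_fun setT s by exact: measurable_sum.
have msx : measurable_fun setT (fun w : Om => s w.1.1.1) by exact: measurableT_comp.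
pose S := n%:R * (M * (2 * r * t * (t * (2 * r) ^+ n.-1))).
have IS : (\int[Th]_w (s w.1.1.1)%:E <= S%:E)%E.
  rewrite (ge0_integral_law mx1 lx1 ms)//.
  under eq_integral do rewrite -sumEFin.
  rewrite ge0_integral_sum; [|exact: measurableT|by move=> i; exact/measurable_EFinP|
    by move=> i x _; rewrite lee_fin].
  apply: (@le_trans _ _ (\sum_(i < n) (M * (2 * r * t * (t * (2 * r) ^+ n.-1)))%:E)%E).
    apply: lee_sum => i _.
    apply: le_trans (density_integral_le mu_density M0 (measurable_cube _) mu_cube (msd i) (sd0 i)) _.
    rewrite EFinM; apply: lee_wpmul2l; first by rewrite lee_fin.
    by apply: integral_second_diff => //; exact: ltW.
  by rewrite sumEFin sumr_const card_ord -[X in (X%:E <= _)%E]mulr_natl.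
(* [gap_comparison], rearranged so that both sides are nonnegative *)
have key : {ae Th, forall w : Om,
    t * dist1 w.1.1.2 w.1.2.2 + n%:R * (c w.1.1.1 w.2.2 + v w.1.1.2) <=
    s w.1.1.1 + (n%:R * (c w.1.1.1 w.1.1.2 + v w.2.2) +
      (4 * r * n%:R * dist1 w.1.1.1 w.1.2.1 + 2 * r * n%:R * dist1 w.1.2.2 w.2.2))}.
  have yy : {ae Th, forall w, cube r w.1.1.2 /\ cube r w.2.2} by move: y1r y2r; apply: filterS2 => w; split.
  have xy : {ae Th, forall w, cube r w.1.1.1 /\ cube r w.1.2.2} by move: x1r yhr; apply: filterS2 => w; split.
  move: yy; apply: filterS3 contact_h xy => -[[[x1 y1] [xh yh]] [x2 y2]] /= ch [xr hr] [yr1 yr2].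
  have ch' : gap phi psi xh yh <= 0 by rewrite /gap subr_le0.
  have := gap_comparison young phi_lip psi_lip (ltW t0) xr yr1 hr yr2 ch'.
  by rewrite (vE _ yr1) (vE _ yr2) /c /s; lra.
have t0' := ltW t0.
have rn4 : 0 <= 4 * r * n%:R by rewrite !mulr_ge0.
have rn2 : 0 <= 2 * r * n%:R by rewrite !mulr_ge0.
have cv12 (w : Om) : 0 <= c w.1.1.1 w.2.2 + v w.1.1.2 :> R by rewrite addr_ge0.
have cv11 (w : Om) : 0 <= c w.1.1.1 w.1.1.2 + v w.2.2 :> R by rewrite addr_ge0.
have dd (w : Om) : 0 <= 4 * r * n%:R * dist1 w.1.1.1 w.1.2.1 + 2 * r * n%:R * dist1 w.1.2.2 w.2.2.
  by rewrite addr_ge0// mulr_ge0// dist1_ge0.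
have mcv12 : measurable_fun setT (fun w : Om => c w.1.1.1 w.2.2 + v w.1.1.2).
  exact: measurable_funD.
have mcv11 : measurable_fun setT (fun w : Om => c w.1.1.1 w.1.1.2 + v w.2.2).
  exact: measurable_funD.
have mZ (k : R) f : measurable_fun setT f -> measurable_fun setT (fun w : Om => k * f w).
  by move=> mf; exact: measurable_funM.
have mdd : measurable_fun setT (fun w : Om =>
    4 * r * n%:R * dist1 w.1.1.1 w.1.2.1 + 2 * r * n%:R * dist1 w.1.2.2 w.2.2).
  by apply: measurable_funD; exact: mZ.
have tD0 (w : Om) : 0 <= t * dist1 w.1.1.2 w.1.2.2 :> R by rewrite mulr_ge0// dist1_ge0.
have ncv12 (w : Om) : 0 <= n%:R * (c w.1.1.1 w.2.2 + v w.1.1.2) :> R by rewrite mulr_ge0.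
have ncv11 (w : Om) : 0 <= n%:R * (c w.1.1.1 w.1.1.2 + v w.2.2) :> R by rewrite mulr_ge0.
have D_le : t * aD <= S + (4 * r * n%:R * d1 + 2 * r * n%:R * d2).
  have : (\int[Th]_w (t * dist1 w.1.1.2 w.1.2.2 +
                      n%:R * (c w.1.1.1 w.2.2 + v w.1.1.2))%:E <=
          \int[Th]_w (s w.1.1.1 + (n%:R * (c w.1.1.1 w.1.1.2 + v w.2.2) +
             (4 * r * n%:R * dist1 w.1.1.1 w.1.2.1 +
              2 * r * n%:R * dist1 w.1.2.2 w.2.2)))%:E)%E.
    apply: ae_ge0_le_integral => //.
    - by move=> w _; rewrite lee_fin addr_ge0.
    - by apply/measurable_EFinP; apply: measurable_funD; exact: mZ.
    - by move=> w _; rewrite lee_fin addr_ge0// addr_ge0.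
    - apply/measurable_EFinP. apply: measurable_funD => //.
      exact: measurable_funD (mZ _ _ mcv11) mdd.
    - by move: key; apply: filterS => w h _; rewrite lee_fin.
  rewrite ge0_integralD_EFin; [|exact: mZ|exact: mZ|by move=> w; rewrite mulr_ge0// dist1_ge0|
    by move=> w; rewrite mulr_ge0].
  rewrite ge0_integralZl_fin//; last by move=> w; exact: dist1_ge0.
  rewrite ge0_integralZl_fin// ge0_integralD_EFin// aDE a12E b1E.
  rewrite ge0_integralD_EFin; [|exact: msx|exact: measurable_funD (mZ _ _ mcv11) mdd|
    by move=> w; exact: s_ge0|by move=> w; rewrite addr_ge0].
  rewrite ge0_integralD_EFin; [|exact: mZ|exact: mdd|exact: ncv11|exact: dd].
  rewrite ge0_integralZl_fin// ge0_integralD_EFin// a11E b2E.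
  rewrite ge0_integralD_EFin; [|exact: mZ|exact: mZ|by move=> w; rewrite mulr_ge0// dist1_ge0|
    by move=> w; rewrite mulr_ge0// dist1_ge0].
  rewrite ge0_integralZl_fin//; last by move=> w; exact: dist1_ge0.
  rewrite ge0_integralZl_fin//; last by move=> w; exact: dist1_ge0.
  rewrite aD1E aD2E; rewrite aD1E lee_fin in ID1; rewrite aD2E lee_fin in ID2.
  rewrite -!EFinD => le_sum.
  have := le_trans le_sum (leeD IS (lexx _)).
  rewrite -EFinD lee_fin b12 => le_real.
  have := ler_wpM2l (ler0n R n) a1112.
  have := ler_wpM2l rn4 ID1; have := ler_wpM2l rn2 ID2.
  by lra.
exists Pi; split => //.
have m11 : measurable_fun setT (fun w : Om => w.1) by exact: measurable_fst.
have mdist : measurable_fun setT (fun z : Z * Z => eucl_dist_prod z.1 z.2 ^+ 2).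
  under eq_fun do rewrite eucl_dist_prod_sqr.
  have mfst11 : measurable_fun setT (fun z : Z * Z => z.1.1).
    exact: measurableT_comp measurable_fst measurable_fst.
  have mfst12 : measurable_fun setT (fun z : Z * Z => z.1.2).
    exact: measurableT_comp measurable_snd measurable_fst.
  have mfst21 : measurable_fun setT (fun z : Z * Z => z.2.1).
    exact: measurableT_comp measurable_fst measurable_snd.
  have mfst22 : measurable_fun setT (fun z : Z * Z => z.2.2).
    exact: measurableT_comp measurable_snd measurable_snd.
  by apply: measurable_funD; apply: measurable_sum => i; apply: measurable_funX;
    apply: measurable_funB; exact: (measurableT_comp (measurable_coord i)).
rewrite -(ge0_integral_law m11 ThC.1 mdist); last by move=> z; exact: sqr_ge0.
have r2 : 0 <= 2 * r by rewrite mulr_ge0.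
apply: (@le_trans _ _ (\int[Th]_w (2 * r * (dist1 w.1.1.1 w.1.2.1 + dist1 w.1.1.2 w.1.2.2))%:E)%E).
  apply: ae_ge0_le_integral => //.
  - by move=> w _; rewrite lee_fin sqr_ge0.
  - by apply/measurable_EFinP; exact: (measurableT_comp mdist m11).
  - by move=> w _; rewrite lee_fin mulr_ge0// addr_ge0// dist1_ge0.
  - by apply/measurable_EFinP; apply: mZ; exact: measurable_funD.
  - have yy : {ae Th, forall w, cube r w.1.1.2 /\ cube r w.1.2.2}.
      by move: y1r yhr; apply: filterS2 => w; split.
    move: yy; apply: filterS3 x1r xhr => w xr hr [yr yr'] _.
    rewrite lee_fin eucl_dist_prod_sqr mulrDr.
    by apply: lerD; exact: sum_sqr_dist1.
rewrite ge0_integralZl_fin//; last 2 first.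
- exact: measurable_funD.
- by move=> w; rewrite addr_ge0// dist1_ge0.
rewrite ge0_integralD_EFin//; [|by move=> w; exact: dist1_ge0|by move=> w; exact: dist1_ge0].
rewrite aD1E aDE -EFinD -EFinM lee_fin; rewrite aD1E lee_fin in ID1.
apply: ler_wpM2l => //; apply: lerD => //.
by rewrite ler_pdivlMr// mulrC.
Qed.

End stability.

(** * A grid of cells *)

Section grid.
Context (R : realType) (n : nat) (r : R) (r0 : 0 < r) (K : nat) (K0 : (0 < K)%N).

(* the cube is rescaled to [0, K]; the top face of the cube makes up a slot of its own,
   hence [K.+1] slots *)
Let rescale (a : R) := (a + r) * (K%:R / (2 * r)).
Let slot (a : R) := minn K (Num.truncn (rescale a)).

Definition grid (x : 'rV[R]_n) : {ffun 'I_n -> 'I_K.+1} :=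
  [ffun i => inord (slot (x ord0 i))].

Let mslot_le j : measurable [set a | (slot a <= j)%N].
Proof.
rewrite (_ : [set a | _] = if (K <= j)%N then setT else rescale @^-1` `]-oo, j.+1%:R[).
  case: ifP => // _; apply: measurable_preT => //.
  by apply: measurable_funM => //; exact: measurable_funD.
apply/seteqP; split=> a; rewrite /slot /= geq_min; case: ifP => //= _;
  by rewrite truncn_le_nat in_itv.
Qed.

Let mslot (j : nat) : measurable (slot @^-1` [set j]).
Proof.
case: j => [|j].
  rewrite (_ : _ @^-1` _ = [set a | (slot a <= 0)%N]) //.
  by apply/seteqP; split=> a /=; rewrite leqn0 => /eqP.
rewrite (_ : _ @^-1` _ = [set a | (slot a <= j.+1)%N] `\` [set a | (slot a <= j)%N]).
  exact: measurableD.
apply/seteqP; split=> a /=; first by move=> ->; rewrite leqnn ltnn.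
by case=> h1 /negP; rewrite -ltnNge => h2; apply/eqP; rewrite eqn_leq h1.
Qed.

Lemma measurable_grid k : measurable (grid @^-1` [set k]).
Proof.
rewrite (_ : _ @^-1` _ =
    [set x : 'rV[R]_n | forall i, (slot @^-1` [set val (k i)]) (x ord0 i)]).
  by apply: (@measurable_rV_box _ _ (fun i => slot @^-1` [set val (k i)])).
apply/seteqP; split=> [x <- i /=|x h /=].
  by rewrite ffunE inordK// ltnS geq_minl.
apply/ffunP => i; rewrite ffunE; apply/val_inj => /=.
by rewrite inordK ?ltnS ?geq_minl//; exact: h.
Qed.

Lemma grid_diam x x' : cube r x -> cube r x' -> grid x = grid x' ->
  dist1 x x' <= n%:R * (2 * r / K%:R).
Proof.
move=> xr xr' xx'.
rewrite (@le_trans _ _ (\sum_(i < n) (2 * r / K%:R)))//; last first.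
  by rewrite sumr_const card_ord -[leLHS]mulr_natl.
have rK a : `|a| <= r -> 0 <= rescale a <= K%:R.
  rewrite ler_norml => /andP[a1 a2].
  have a0 : 0 <= a + r by lra.
  have r2 : 0 < 2 * r by rewrite mulr_gt0.
  rewrite /rescale mulr_ge0 ?divr_ge0 ?(ltW r2)//=.
  by rewrite mulrA ler_pdivrMr// mulrC ler_wpM2l//; lra.
have slotE a : `|a| <= r -> slot a = Num.truncn (rescale a).
  move=> /rK/andP[a0 aK]; apply/minn_idPr.
  by rewrite -ltnS -(ltr_nat R) (le_lt_trans (y := rescale a)) ?truncn_le// (le_lt_trans aK)// ltr_nat.
apply: ler_sum => i _.
have /(congr1 val) /= := congr1 (fun f : {ffun _ -> _} => f i) xx'.
rewrite !ffunE !inordK ?ltnS ?geq_minl// !slotE//.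
have /andP[h1 _] := rK _ (xr i); have /andP[h2 _] := rK _ (xr' i).
have := truncn_itv h1; have := truncn_itv h2 => + + e.
rewrite e -(natr1 (Num.truncn _)) => /andP[u1 u2] /andP[u3 u4].
have K0' : 0 < K%:R :> R by rewrite ltr0n.
have : `|rescale (x ord0 i) - rescale (x' ord0 i)| <= 1.
  by rewrite ler_norml; apply/andP; split; lra.
have -> : rescale (x ord0 i) - rescale (x' ord0 i) =
    (x ord0 i - x' ord0 i) * (K%:R / (2 * r)) by rewrite -mulrBl; congr (_ * _); lra.
have c0 : 0 < K%:R / (2 * r) by rewrite divr_gt0// mulr_gt0.
rewrite normrM (gtr0_norm c0) -ler_pdivlMr// => /le_trans; apply.
by rewrite div1r invf_div.
Qed.

Lemma card_grid : #|{: {ffun 'I_n -> 'I_K.+1}}| = (K.+1 ^ n)%N.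
Proof. by rewrite card_ffun !card_ord. Qed.

End grid.

(** * Deviation of the empirical measure on a finite partition *)

Section empirical_deviation.
Context d d' (Omega : measurableType d) (T : measurableType d') (R : realType).
Context (P : probability Omega R) (mu : probability T R).
Context (N : nat) (X : 'I_N -> {RV P >-> T}).
Hypotheses (N0 : (0 < N)%N) (Xiid : iid_sample X mu).

Section one_event.
Context (A : set T) (mA : measurable A).

Let B i := X i @^-1` A.
Let a := fine (mu A).

Let mB i : measurable (B i).
Proof. exact: measurable_preT. Qed.

Let aE : mu A = a%:E. Proof. by rewrite fineK// fin_num_measure. Qed.

Let a0 : 0 <= a. Proof. exact/fine_ge0/measure_ge0. Qed.

Let PB i : P (B i) = a%:E.
Proof. by rewrite -aE -(Xiid.2 i _ mA). Qed.

Let PBB i j : P (B i `&` B j) = (if i == j then a else a ^+ 2)%:E.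
Proof.
case: eqVneq => [->|ij]; first by rewrite setIid PB.
have := Xiid.1 [set i; j]%SET (fun=> A) (fun=> mA).
rewrite big_setU1 ?inE//= big_set1.
have -> : P (X i @^-1` A) = a%:E by exact: PB.
have -> : P (X j @^-1` A) = a%:E by exact: PB.
rewrite -EFinM -expr2 => <-; congr (P _).
apply/seteqP; split=> [w [wi wj] k|w h].
  by rewrite !inE => /orP[] /eqP ->.
by split; apply: h; rewrite !inE eqxx ?orbT.
Qed.

Let cnt (w : Omega) : R := \sum_i \1_(B i) w.

Let mcnt : measurable_fun setT cnt.
Proof. by apply: measurable_sum => i; exact: measurable_indic. Qed.

Let N1 : 0 < N%:R :> R. Proof. by rewrite ltr0n. Qed.

Let Ecnt : (\int[P]_w (cnt w)%:E = (N%:R * a)%:E)%E.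
Proof.
under eq_integral do rewrite -sumEFin.
rewrite ge0_integral_sum; [|exact: measurableT|
  by move=> i; apply/measurable_EFinP; exact: measurable_indic|by move=> i w _; rewrite lee_fin].
under eq_bigr do rewrite integral_indic// setIT.
rewrite (eq_bigr (fun=> a%:E)) => [|i _]; last exact: PB.
by rewrite sumEFin sumr_const card_ord mulr_natl.
Qed.

Let Ecnt2 : (\int[P]_w (cnt w ^+ 2)%:E = (N%:R * a + N%:R * (N%:R - 1) * a ^+ 2)%:E)%E.
Proof.
have cE w : cnt w ^+ 2 = \sum_i \sum_j \1_(B i `&` B j) w.
  rewrite expr2 /cnt mulr_suml; apply: eq_bigr => i _; rewrite mulr_sumr.
  by apply: eq_bigr => j _; rewrite indicI.
under eq_integral do rewrite cE -sumEFin.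
rewrite ge0_integral_sum; [|exact: measurableT| |]; last 2 first.
- move=> i; apply/measurable_EFinP; apply: measurable_sum => j.
  by apply: measurable_indic; exact: measurableI.
- by move=> i w _; rewrite lee_fin sumr_ge0.
rewrite (eq_bigr (fun=> (a + (N%:R - 1) * a ^+ 2)%:E)).
  rewrite sumEFin sumr_const card_ord; congr (_%:E).
  by rewrite -[LHS]mulr_natl mulrDr mulrA.
move=> i _; under eq_integral do rewrite -sumEFin.
rewrite ge0_integral_sum; [|exact: measurableT| |]; last 2 first.
- move=> j; apply/measurable_EFinP.
  by apply: measurable_indic; exact: measurableI.
- by move=> j w _; rewrite lee_fin.
rewrite (eq_bigr (fun j => (if i == j then a else a ^+ 2)%:E)) => [|j _]; last first.
  by rewrite integral_indic ?setIT//; [exact: PBB|exact: measurableI].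
rewrite sumEFin; congr (_%:E); rewrite (bigD1 i)//= eqxx; congr (_ + _).
rewrite (eq_bigr (fun=> a ^+ 2)) => [|j /negbTE ji]; last by rewrite eq_sym ji.
rewrite sumr_const cardC1 card_ord -[LHS]mulr_natl; congr (_ * _).
by rewrite -subn1 natrB.
Qed.

(* the expansion of the square is arranged so that both sides are nonnegative *)
Let Evar : (\int[P]_w ((cnt w - N%:R * a) ^+ 2)%:E <= (N%:R * a)%:E)%E.
Proof.
have mvar : measurable_fun setT (fun w => (cnt w - N%:R * a) ^+ 2).
  by apply: measurable_funX; exact: measurable_funB.
have c0 w : 0 <= cnt w by apply: sumr_ge0.
have Na0 : 0 <= N%:R * a by rewrite mulr_ge0.
have : (\int[P]_w ((cnt w - N%:R * a) ^+ 2 + (2 * (N%:R * a)) * cnt w)%:E =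
        \int[P]_w (cnt w ^+ 2 + (N%:R * a) ^+ 2)%:E)%E.
  by apply: eq_integral => w _; congr (_%:E); rewrite sqrrB; lra.
under eq_integral do rewrite EFinD.
under [RHS]eq_integral do rewrite EFinD.
rewrite ge0_integralD//; last 4 first.
- by move=> w _; rewrite lee_fin sqr_ge0.
- exact/measurable_EFinP.
- by move=> w _; rewrite lee_fin !mulr_ge0.
- by apply/measurable_EFinP; exact: measurable_funM.
rewrite ge0_integralD//; last 3 first.
- by move=> w _; rewrite lee_fin sqr_ge0.
- by apply/measurable_EFinP; exact: measurable_funX.
- by move=> w _; rewrite lee_fin sqr_ge0.
under [X in (_ + X)%E = _]eq_integral do rewrite EFinM.
rewrite ge0_integralZl_EFin//; last 3 first.
- by move=> w _; rewrite lee_fin.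
- exact/measurable_EFinP.
- by rewrite mulr_ge0.
rewrite Ecnt Ecnt2 integral_cst_prob.
have If : (\int[P]_w ((cnt w - N%:R * a) ^+ 2)%:E)%E \is a fin_num.
  rewrite ge0_fin_numE; last by apply: integral_ge0 => w _; rewrite lee_fin sqr_ge0.
  have cN w : cnt w <= N%:R.
    rewrite (@le_trans _ _ (\sum_(i < N) 1))//; last by rewrite sumr_const card_ord.
    by apply: ler_sum => i _; rewrite indicE lern1 leq_b1.
  apply: le_lt_trans (ge0_ae_bounded_integral (C := (N%:R + N%:R * a) ^+ 2) mvar _ _ _) _.
  - by move=> w; exact: sqr_ge0.
  - exact: sqr_ge0.
  - apply: aeW => w; rewrite -real_normK ?num_real// ler_pXn2r// ?nnegrE ?addr_ge0//.
    by rewrite (le_trans (ler_normB _ _))// lerD// ger0_norm.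
  - by rewrite ltry.
rewrite -(fineK If) -!EFinD => h; have e := EFin_inj h; rewrite lee_fin.
have : 0 <= N%:R * a ^+ 2 by rewrite mulr_ge0// sqr_ge0.
by move: e; rewrite exprMn; nra.
Qed.

(** The variance bound turned into a first moment by [2 * lam * g <= g ^+ 2 + lam ^+ 2];
    the parameter [lam] stands for the square root that the Cauchy-Schwarz inequality
    would produce. *)
Lemma expected_deviation (lam : R) : 0 < lam ->
  (\int[P]_w `|a - N%:R^-1 * cnt w|%:E <= (2^-1 * (a / (N%:R * lam) + lam))%:E)%E.
Proof.
move=> lam0.
have mvar : measurable_fun setT (fun w => (cnt w - N%:R * a) ^+ 2).
  by apply: measurable_funX; exact: measurable_funB.
pose k : R := (2 * (N%:R ^+ 2 * lam))^-1.
have k0 : 0 <= k by rewrite invr_ge0 !mulr_ge0// ?sqr_ge0// ltW.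
apply: (@le_trans _ _ (\int[P]_w (k * (cnt w - N%:R * a) ^+ 2 + 2^-1 * lam)%:E)%E).
  apply: ge0_le_integral => //.
  - apply/measurable_EFinP; apply: measurableT_comp => //.
    by apply: measurable_funB => //; exact: measurable_funM.
  - by apply/measurable_EFinP; apply: measurable_funD => //; exact: measurable_funM.
  - move=> w _; rewrite lee_fin.
    set g := a - _.
    have -> : k * (cnt w - N%:R * a) ^+ 2 = `|g| ^+ 2 / (2 * lam).
      rewrite real_normK ?num_real// /g /k; field.
      by rewrite !gt_eqF.
    rewrite -subr_ge0 (_ : _ - _ = (`|g| - lam) ^+ 2 / (2 * lam)).
      by rewrite divr_ge0 ?sqr_ge0// mulr_ge0// ltW.
    by field; rewrite gt_eqF.
under eq_integral do rewrite addrC.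
rewrite ge0_integral_affine//; last 2 first.
- by move=> w; exact: sqr_ge0.
- by rewrite mulr_ge0// ltW.
apply: le_trans (leeD (lexx _) (lee_wpmul2l _ Evar)) _; first by rewrite lee_fin.
rewrite -EFinM -EFinD lee_fin le_eqVlt; apply/orP; left; apply/eqP.
by rewrite /k; field; rewrite !gt_eqF.
Qed.

End one_event.

Section all_labels.
Context (F : finType) (q : T -> F) (mq : forall k, measurable (q @^-1` [set k])).

Lemma fine_empirical_measure (x : 'I_N -> T) A :
  fine (empirical_measure R x A) = N%:R^-1 * \sum_i \1_A (x i).
Proof. by rewrite /empirical_measure sumEFin -EFinM. Qed.

Lemma measurable_empirical_label_gap :
  measurable_fun setT (fun w => label_gap q mu (empirical_measure R (fun i => X i w))).
Proof.
apply: measurable_sum => k; apply: measurableT_comp => //.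
apply: measurable_funB => //.
under eq_fun do rewrite fine_empirical_measure.
apply: measurable_funM => //; apply: measurable_sum => i.
have mi : measurable_fun setT (\1_(q @^-1` [set k]) : T -> R) by exact: measurable_indic.
  apply: (measurableT_comp mi).
exact: measurable_funP.
Qed.

Lemma expected_label_gap (lam : R) : 0 < lam ->
  (\int[P]_w (label_gap q mu (empirical_measure R (fun i => X i w)))%:E <= (2^-1 * ((N%:R * lam)^-1 + #|F|%:R * lam))%:E)%E.
Proof.
move=> lam0.
under eq_integral do rewrite /label_gap -sumEFin.
rewrite ge0_integral_sum; [|exact: measurableT| |]; last 2 first.
- move=> k; apply/measurable_EFinP; apply: measurableT_comp => //.
  apply: measurable_funB => //.
  under eq_fun do rewrite fine_empirical_measure.
  apply: measurable_funM => //; apply: measurable_sum => i.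
  have mi : measurable_fun setT (\1_(q @^-1` [set k]) : T -> R) by exact: measurable_indic.
  apply: (measurableT_comp mi).
  exact: measurable_funP.
- by move=> k w _; rewrite lee_fin.
apply: (@le_trans _ _ (\sum_k (2^-1 * (fine (mu (q @^-1` [set k])) / (N%:R * lam) + lam))%:E)%E).
  apply: lee_sum => k _; apply: le_trans (expected_deviation (mq k) lam0).
  rewrite le_eqVlt; apply/orP; left; apply/eqP; apply: eq_integral => w _.
  by rewrite fine_empirical_measure.
rewrite sumEFin lee_fin -mulr_sumr big_split /= -mulr_suml sumr_const.
have -> : \sum_k fine (mu (q @^-1` [set k])) = 1.
  apply: EFin_inj; rewrite -sumEFin -(@probability_setT _ _ _ mu).
  rewrite -(sum_preimage_fin mu mq measurableT).
  by apply: eq_bigr => k _; rewrite setTI fineK// fin_num_measure.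
by rewrite mul1r -[X in 2^-1 * (_ + X) <= _]mulr_natl.
Qed.

End all_labels.
End empirical_deviation.

(** * Supports *)

Section support.
Context (R : realType) (n : nat).

Let box (p : 'rV[rat]_n * nat) : set 'rV[R]_n :=
  [set x | forall i, `|ratr (p.1 ord0 i) - x ord0 i| < p.2.+1%:R^-1].

Let measurable_box p : measurable (box p).
Proof.
rewrite (_ : box p = [set x | forall i, `]ratr (p.1 ord0 i) - p.2.+1%:R^-1,
      ratr (p.1 ord0 i) + p.2.+1%:R^-1[%classic (x ord0 i)]).
  by apply: (@measurable_rV_box _ _ (fun=> _)) => i; exact: measurable_itv.
by apply/seteqP; split=> x bx i; have := bx i; rewrite /= in_itv/= ltr_distlC.
Qed.

Let box_nbhs (U : set 'rV[R]_n) x : open U -> U x ->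
  exists p, box p x /\ box p `<=` U.
Proof.
rewrite openE => oU /oU /nbhs_ballP[e /= e0 eU].
have [k ke] : exists k : nat, k.+1%:R^-1 < e / 2.
  have /ltr_add_invr[k] : 0 < e / 2 by rewrite divr_gt0.
  by rewrite add0r; exists k.
have /choice[q Hq] : forall i : 'I_n, exists q : rat,
    `|ratr q - x ord0 i| < k.+1%:R^-1.
  move=> i; have /rat_in_itvoo[q] : x ord0 i < x ord0 i + k.+1%:R^-1 :> R.
    by rewrite ltrDl invr_gt0.
  rewrite in_itv /= => /andP[q1 q2]; exists q.
  by rewrite ger0_norm ?subr_ge0 1?ltW// ltrBlDl.
exists (\row_i q i, k); split; first by move=> i; rewrite mxE.
move=> y yp; apply: eU; split=> // i j; rewrite !ord1 /ball /=.
rewrite [e]splitr -(subrKA (ratr (q j))) (le_lt_trans (ler_normD _ _))//.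
by rewrite ltrD// (lt_trans _ ke)//; [rewrite distrC; exact: Hq|have := yp j; rewrite mxE].
Qed.

(** The complement of the support is the union of the countably many null boxes with
    rational center and size [1 / k]. *)
Lemma ae_msupport (mu : probability 'rV[R]_n R) : {ae mu, forall x, msupport mu x}.
Proof.
pose null k : set 'rV[R]_n :=
  if unpickle k is Some p then if mu (box p) == 0%E then box p else set0 else set0.
have nullP k : mu.-negligible (null k).
  rewrite /null; case: (unpickle k) => [p|]; last exact: negligible_set0.
  case: eqP => [p0|_]; last exact: negligible_set0.
  by exists (box p); split.
apply: negligibleS (negligible_bigcup nullP) => x /=.
move=> /existsNP[U /not_implyP[oU /not_implyP[Ux muU]]].
have [p [px pU]] := box_nbhs oU Ux.
exists (pickle p) => //; rewrite /null pickleK ifT//.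
have pleU : (mu (box p) <= mu U)%E.
  by apply: le_measure; rewrite ?inE//; exact: sub_sigma_algebra.
rewrite eq_le measure_ge0 andbT leNgt; apply/negP => p0.
by apply: muU; exact: lt_le_trans pleU.
Qed.

Lemma eucl_ball_cube (r : R) : @eucl_ball R n r `<=` cube r.
Proof.
move=> x; rewrite /eucl_ball /= /eucl_norm => /ltW xr i.
apply: le_trans xr; rewrite -sqrtr_sqr ler_wsqrtr//.
by rewrite (bigD1 i)//= lerDl sumr_ge0// => j _; exact: sqr_ge0.
Qed.

Lemma ae_cube (mu : probability 'rV[R]_n R) (r : R) :
  compactly_supported_in mu (@eucl_ball R n r) -> {ae mu, forall x, cube r x}.
Proof.
move=> [_ sr]; move: (ae_msupport mu); apply: filterS => x xs.
exact/eucl_ball_cube/sr.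
Qed.

End support.

Section empirical_support.
Context (R : realType) (n N N' : nat) (x : 'I_N -> 'rV[R]_n) (y : 'I_N' -> 'rV[R]_n).
Context (gam : probability ('rV[R]_n * 'rV[R]_n)%type R).
Hypothesis gamC : is_coupling (empirical_measure R x) (empirical_measure R y) gam.

Let measurable_range K (z : 'I_K -> 'rV[R]_n) : measurable [set p | p \in codom z].
Proof.
rewrite (_ : [set p | _] = \bigcup_(i in [set: 'I_K]) [set z i]).
  by apply: fin_bigcup_measurable => // i _; exact: measurable_rV1.
apply/seteqP; split=> [p /codomP[i ->]|p [i _ ->]]; first by exists i.
exact: codom_f.
Qed.

Let empirical0 K (z : 'I_K -> 'rV[R]_n) :
  empirical_measure R z (~` [set p | p \in codom z]) = 0%E.
Proof.
rewrite /empirical_measure big1 ?mule0// => i _.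
rewrite diracE memNset// => /=; apply; exact: codom_f.
Qed.

Lemma empirical_coupling_support :
  {ae gam, forall z, z \in [seq (a, b) | a <- codom x, b <- codom y]}.
Proof.
have hx : {ae gam, forall z, z.1 \in codom x}.
  exists (fst @^-1` (~` [set p | p \in codom x])); split.
  - by apply: measurable_preT; [exact: measurable_fst|exact: measurableC].
  - by rewrite -(empirical0 x) -gamC.1//; exact: measurableC.
  - by move=> z.
have hy : {ae gam, forall z, z.2 \in codom y}.
  exists (snd @^-1` (~` [set p | p \in codom y])); split.
  - by apply: measurable_preT; [exact: measurable_snd|exact: measurableC].
  - by rewrite -(empirical0 y) -gamC.2//; exact: measurableC.
  - by move=> z.
move: hx hy; apply: filterS2 => -[a b] /= ax yb.
by apply/allpairsP; exists (a, b).
Qed.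

End empirical_support.

(** * Rates *)

Section rates.
Context (R : realType) (d : nat).
Let D := maxn d 4.

(** The order of the size of the cells for [N] sample points: small enough for the
    target rate, and large enough for the sampling error of the cell masses, which
    grows with the number of cells, to stay below it. *)
Definition mesh (N : nat) : R := N%:R `^ (- (2 * D%:R)^-1).

Let D4 : 4 <= D%:R :> R.
Proof. by rewrite ler_nat leq_maxr. Qed.

Let D0 : 0 < D%:R :> R. Proof. by apply: lt_le_trans D4. Qed.

Lemma mesh_gt0 N : (0 < N)%N -> 0 < mesh N.
Proof. by move=> N0; rewrite powR_gt0// ltr0n. Qed.

Lemma mesh_le1 N : (0 < N)%N -> mesh N <= 1.
Proof.
move=> N0; rewrite -[leRHS](powRr0 N%:R); apply: ler_powR; first by rewrite ler1n.
by rewrite oppr_le0 invr_ge0 mulr_ge0// ltW.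
Qed.

(** [K] is the integer part of the inverse of the mesh; the [K ^ d] cells number at
    most [N `^ (d / (2 * D))], hence [N `^ 2^-1]. *)
Lemma grid_size N : (0 < N)%N -> exists2 K : nat, (0 < K)%N &
  K%:R^-1 <= 2 * mesh N /\ (K.+1 ^ d)%:R <= 2 ^+ d * N%:R `^ 2^-1 :> R.
Proof.
move=> N0; pose y : R := N%:R `^ (2 * D%:R)^-1.
have N1 : 1 <= N%:R :> R by rewrite ler1n.
have y1 : 1 <= y.
  by rewrite -[leLHS](powRr0 N%:R); apply: ler_powR.
have y0 : 0 < y by exact: lt_le_trans y1.
have /andP[Ky yK] := truncn_itv (ltW y0).
exists (Num.truncn y); first by rewrite truncn_gt0.
set K := Num.truncn y in Ky yK *.
have K1 : (1 <= K)%N by rewrite truncn_gt0.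
have KS : (K.+1 <= 2 * K)%N by rewrite mul2n -addnn -addn1 leq_add2l.
have K0' : 0 < K%:R :> R by rewrite ltr0n.
split.
  rewrite /mesh powRN -/y -[2]invrK -invfM lef_pV2 ?posrE ?mulr_gt0//.
  rewrite ler_pdivrMl//; apply/ltW; apply: lt_le_trans yK _.
  by rewrite -natrM ler_nat.
rewrite natrX; apply: (@le_trans _ _ ((2 * K%:R) ^+ d)).
  by apply: lerXn2r; rewrite ?nnegrE ?mulr_ge0// -natrM ler_nat.
rewrite exprMn ler_wpM2l ?exprn_ge0//.
apply: (@le_trans _ _ (K%:R ^+ D)).
  by apply: ler_weXn2l; [rewrite ler1n|exact: leq_maxl].
apply: (@le_trans _ _ (y ^+ D)).
  by apply: lerXn2r => //; rewrite nnegrE ltW.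
rewrite -powR_mulrn; last exact: ltW.
rewrite /y -powRrM.
by rewrite invfM divfK ?gt_eqF.
Qed.

Lemma quarter_le_mesh N : (0 < N)%N -> N%:R `^ (- 4^-1) <= mesh N.
Proof.
move=> N0; apply: ler_powR; first by rewrite ler1n.
rewrite lerN2 lef_pV2 ?posrE//; last by rewrite mulr_gt0.
by have := D4; lra.
Qed.

(** The exponent [- (3 / 4)] balances the two terms of [expected_label_gap] when the
    grid has [N `^ 2^-1] cells. *)
Lemma deviation_mesh N (c : R) : (0 < N)%N ->
  c <= 2 ^+ d * N%:R `^ 2^-1 ->
  2^-1 * ((N%:R * N%:R `^ (- (3 / 4)))^-1 + c * N%:R `^ (- (3 / 4))) <= 2 ^+ d * mesh N.
Proof.
move=> N0 cN.
have N0' : 0 < N%:R :> R by rewrite ltr0n.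
have e1 : (N%:R * N%:R `^ (- (3 / 4)))^-1 = N%:R `^ (- 4^-1) :> R.
  rewrite -[X in X * _](powRr1 (ltW N0')) -powRD; last by rewrite (gt_eqF N0') implybT.
  by rewrite -powRN; congr (_ `^ _); field.
have e2 : c * N%:R `^ (- (3 / 4)) <= 2 ^+ d * N%:R `^ (- 4^-1).
  apply: le_trans (ler_wpM2r (powR_ge0 _ _) cN) _.
  rewrite -mulrA -powRD; last by rewrite (gt_eqF N0') implybT.
  by have -> : 2^-1 + - (3 / 4) = - 4^-1 :> R by field.
have p0 : 0 <= N%:R `^ (- 4^-1) :> R by exact: powR_ge0.
have d1 : 1 <= 2 ^+ d :> R by rewrite exprn_ege1// ler1n.
have := ler_wpM2l (le_trans ler01 d1) (quarter_le_mesh N0).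
have : N%:R `^ (- 4^-1) <= 2 ^+ d * N%:R `^ (- 4^-1) :> R by rewrite ler_peMl.
by rewrite e1; lra.
Qed.

Lemma ln2_ge : 2^-1 <= ln (2 : R).
Proof.
have := @le_ln1Dx R (- 2^-1); rewrite (_ : 1 + - 2^-1 = 2^-1 :> R); last by field.
by rewrite lnV ?posrE// => /(_ _); rewrite lerN2; apply; lra.
Qed.

Let log_ge N : (0 < N)%N -> 4^-1 <= Num.sqrt (ln (1 + N%:R)) :> R.
Proof.
move=> N0; rewrite -[leLHS]ger0_norm// -sqrtr_sqr ler_wsqrtr//.
apply: (@le_trans _ _ (ln 2)); first by have := ln2_ge; lra.
rewrite ler_ln ?posrE ?addr_gt0 ?ltr0n//.
by have : 1 <= N%:R :> R by [rewrite ler1n]; lra.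
Qed.

(** With [a] and [b] the meshes of the two samples, [a ^+ 2] and [b ^+ 2] are the terms
    of [rate], up to a logarithm bounded below when [d = 4], and
    [(a + b) ^+ 2 <= 2 * (a ^+ 2 + b ^+ 2)]. *)
Lemma mesh_rate n m : (0 < n)%N -> (0 < m)%N ->
  (mesh n + mesh m) `^ 4^-1 <= 8 * rate R d n m.
Proof.
move=> n0 m0; set a := mesh n; set b := mesh m.
have a0 : 0 <= a by exact: powR_ge0.
have b0 : 0 <= b by exact: powR_ge0.
have [Y Y0 [-> abY]] : exists2 Y, 0 <= Y & rate R d n m = Y `^ 8^-1 /\
    (a + b) ^+ 2 <= 8 * Y.
  have sq : (a + b) ^+ 2 <= 2 * (a ^+ 2 + b ^+ 2).
    by have := sqr_ge0 (a - b); rewrite sqrrB sqrrD; lra.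
  have mesh2 N : (0 < N)%N -> mesh N ^+ 2 = N%:R `^ (- D%:R^-1).
    move=> N0; rewrite -powR_mulrn ?powR_ge0// -powRrM; congr (_ `^ _).
    by rewrite invfM mulNr mulrAC mulVf ?mul1r// pnatr_eq0.
  rewrite /rate; case: ltnP => d4.
    have DE : D = 4%N by rewrite /D; apply/maxn_idPr/ltnW.
    exists (n%:R `^ (- 4^-1) + m%:R `^ (- 4^-1)); first by rewrite addr_ge0 ?powR_ge0.
    split => //; move: (mesh2 n n0) (mesh2 m m0); rewrite DE => <- <-.
    by have := sqr_ge0 a; have := sqr_ge0 b; rewrite -/a -/b; lra.
  case: eqP => [dE|dn].
    have DE : D = 4%N by rewrite /D dE.
    exists (n%:R `^ (- 4^-1) * Num.sqrt (ln (1 + n%:R)) +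
            m%:R `^ (- 4^-1) * Num.sqrt (ln (1 + m%:R))).
      by rewrite addr_ge0 ?mulr_ge0 ?powR_ge0.
    split => //; move: (mesh2 n n0) (mesh2 m m0); rewrite DE => <- <-.
    have := ler_wpM2l (sqr_ge0 a) (log_ge n0); have := ler_wpM2l (sqr_ge0 b) (log_ge m0).
    by rewrite -/a -/b; lra.
  have DE : D = d by rewrite /D; apply/maxn_idPl.
  exists (n%:R `^ (- d%:R^-1) + m%:R `^ (- d%:R^-1)); first by rewrite addr_ge0 ?powR_ge0.
  split => //; move: (mesh2 n n0) (mesh2 m m0); rewrite DE => <- <-.
  by have := sqr_ge0 a; have := sqr_ge0 b; rewrite -/a -/b; lra.
have -> : 4^-1 = 2%:R * 8^-1 :> R by field.
rewrite powRrM powR_mulrn ?addr_ge0//.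
apply: (@le_trans _ _ ((8 * Y) `^ 8^-1)).
  by apply: ge0_ler_powR; rewrite ?nnegrE ?sqr_ge0 ?mulr_ge0.
rewrite powRM// ler_wpM2r ?powR_ge0//.
by apply: ler1_powR; lra.
Qed.

End rates.

(** * The expected distance *)

Section W2_bound.
Context d (T : measurableType d) (R : realType) (dist : T -> T -> R).

Lemma W2_le (alpha beta : set T -> \bar R) (Pi : probability (T * T)%type R) (v s : R) :
  is_coupling alpha beta Pi ->
  (\int[Pi]_z (dist z.1 z.2 ^+ 2)%:E <= v%:E)%E -> 0 < s ->
  (W2 dist alpha beta <= (2^-1 * (v / s + s))%:E)%E.
Proof.
move=> PiC Pi_le s0.
have I_ge0 (Q : probability (T * T)%type R) :
    (0 <= \int[Q]_z (dist z.1 z.2 ^+ 2)%:E)%E.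
  by apply: integral_ge0 => z _; rewrite lee_fin sqr_ge0.
have v0 : 0 <= v by rewrite -lee_fin; exact: le_trans (I_ge0 Pi) Pi_le.
rewrite /W2; set i := ereal_inf _.
have i0 : (0 <= i)%E by apply: le_ereal_inf_tmp => _ [Q _ <-]; exact: I_ge0.
have iv : (i <= v%:E)%E.
  by apply: le_trans Pi_le; apply: ereal_inf_lbound; exists Pi.
apply: (@le_trans _ _ (v%:E `^ 2^-1)%E).
  by apply: gt0_ler_poweR => //; rewrite in_itv/= leey andbT// lee_fin.
rewrite poweR_EFin lee_fin powR12_sqrt//.
have := sqr_ge0 (Num.sqrt v - s); rewrite sqrrB sqr_sqrtr// => h.
rewrite -subr_ge0 (_ : _ - _ = (v - Num.sqrt v * s *+ 2 + s ^+ 2) / (2 * s)).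
  by rewrite divr_ge0// mulr_ge0// ltW.
by rewrite -mulr_natr; field; rewrite gt_eqF.
Qed.

End W2_bound.

Section empirical_plans.
Context (R : realType) (M r : R) (d : nat) (hM : 0 < M) (hr : 0 < r).
Context (mu nu : probability 'rV[R]_d R).
Hypothesis mu_supp : compactly_supported_in mu (@eucl_ball R d r).
Hypothesis nu_supp : compactly_supported_in nu (@eucl_ball R d r).
Hypothesis mu_density : has_density_bounded_by mu M.
Context (gam : probability ('rV[R]_d * 'rV[R]_d)%type R).
Hypothesis gam_opt : optimal_coupling mu nu gam.

Let Bd := d%:R * (M * (2 * r * (2 * r) ^+ d.-1)).
Definition step_cst := 2 * r * Bd + 1.
Definition deviation_cst := 2 * r * (2 + 4 * r * d%:R).

(** [coupling_stability] with step [s ^+ 2], after the square root is linearised by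
    [W2_le]: the bound is affine in the two label gaps, so that it can be
    integrated. *)
Lemma W2_empirical_le n m (x : 'I_n -> 'rV[R]_d) (y : 'I_m -> 'rV[R]_d)
    (ghat : probability ('rV[R]_d * 'rV[R]_d)%type R) (K1 K2 : nat) (s : R) :
  (forall i, cube r (x i)) -> (forall j, cube r (y j)) ->
  optimal_coupling (empirical_measure R x) (empirical_measure R y) ghat ->
  (0 < K1)%N -> (0 < K2)%N -> 0 < s -> s ^+ 2 <= 2 ->
  (W2 (@eucl_dist_prod R d) gam ghat <=
   (step_cst * s + deviation_cst / s ^+ 3 *
      ((d%:R * (2 * r / K1%:R) +
        d%:R * (2 * r) * label_gap (grid r K1) mu (empirical_measure R x)) +
       (d%:R * (2 * r / K2%:R) +
        d%:R * (2 * r) * label_gap (grid r K2) nu (empirical_measure R y))))%:E)%E.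
Proof.
move=> xr yr ghat_opt K1_gt0 K2_gt0 s0 s2.
have suppC z : z \in [seq (a, b) | a <- codom x, b <- codom y] ->
    cube r z.1 /\ cube r z.2.
  by move=> /allpairsP[[a b] /= [/codomP[i ->] /codomP[j ->] ->]]; split; [exact: xr|exact: yr].
have r0 := ltW hr.
have eta0 K : 0 <= d%:R * (2 * r / K%:R) by rewrite mulr_ge0// divr_ge0// mulr_ge0.
have s20 : 0 < s ^+ 2 by rewrite exprn_gt0.
have [Pi [PiC]] := coupling_stability hr (ltW hM) mu_density (ae_cube mu_supp)
  (ae_cube nu_supp) gam_opt ghat_opt suppC (empirical_coupling_support ghat_opt.1)
  (@measurable_grid R d r K1) (@measurable_grid R d r K2) (grid_diam hr K1_gt0)
  (grid_diam hr K2_gt0) (eta0 _) (eta0 _) s20.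
move=> /(W2_le PiC) /(_ s0) /le_trans; apply; rewrite lee_fin.
have -> : label_gap (grid r K2) (empirical_measure R y) nu =
          label_gap (grid r K2) nu (empirical_measure R y).
  exact: label_gapC.
have gap0 K (a b : set 'rV[R]_d -> \bar R) : 0 <= d%:R * (2 * r) * label_gap (grid r K) a b.
  by apply: mulr_ge0; [rewrite !mulr_ge0|exact: label_gap_ge0].
set d1 := _ + _ * label_gap (grid r K1) _ _; set d2 := _ + _ * label_gap (grid r K2) _ _.
have d10 : 0 <= d1 by exact: addr_ge0.
have d20 : 0 <= d2 by exact: addr_ge0.
have d1s : d1 / s <= 2 * (d1 / s ^+ 3).
  rewrite (_ : d1 / s = s ^+ 2 * (d1 / s ^+ 3)); last by field; rewrite gt_eqF.
  by rewrite ler_wpM2r// divr_ge0// exprn_ge0// ltW.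
have Bd0 : 0 <= Bd by rewrite !mulr_ge0 ?exprn_ge0 ?mulr_ge0// ltW.
have -> : 2 * r * (d1 + (d%:R * (M * (2 * r * s ^+ 2 * (s ^+ 2 * (2 * r) ^+ d.-1))) +
      (4 * r * d%:R * d1 + 2 * r * d%:R * d2)) / s ^+ 2) / s =
   2 * r * (d1 / s) + 2 * r * Bd * s +
     2 * r * (4 * r * d%:R * (d1 / s ^+ 3) + 2 * r * d%:R * (d2 / s ^+ 3)).
  by rewrite /Bd; field; rewrite gt_eqF.
have -> : deviation_cst / s ^+ 3 * (d1 + d2) =
    2 * r * (2 * (d1 / s ^+ 3) + 2 * (d2 / s ^+ 3) +
             (4 * r * d%:R * (d1 / s ^+ 3) + 4 * r * d%:R * (d2 / s ^+ 3))).
  by rewrite /deviation_cst; field; rewrite gt_eqF.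
have e1 : 0 <= d1 / s ^+ 3 by rewrite divr_ge0// exprn_ge0// ltW.
have e2 : 0 <= d2 / s ^+ 3 by rewrite divr_ge0// exprn_ge0// ltW.
have r20 : 0 <= 2 * r by rewrite mulr_ge0.
have h1 := ler_wpM2l r20 d1s.
have rd : 0 <= 2 * r * d%:R by rewrite mulr_ge0.
have h2 := mulr_ge0 (mulr_ge0 r20 rd) e1.
have h3 := mulr_ge0 (mulr_ge0 r20 rd) e2.
have h4 := mulr_ge0 r20 e2.
have h5 := mulr_ge0 r20 e1.
have h6 := mulr_ge0 (mulr_ge0 r20 Bd0) (ltW s0).
by rewrite /step_cst; lra.
Qed.

End empirical_plans.

Section expected_bound.
Context (R : realType) (r : R) (d : nat) (hr : 0 < r).
Context (mu : probability 'rV[R]_d R).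
Context (disp : measure_display) (Omega : measurableType disp) (P : probability Omega R).
Context (N : nat) (N0 : (0 < N)%N) (X : 'I_N -> {RV P >-> 'rV[R]_d}).
Hypothesis Xiid : iid_sample X mu.

Lemma ae_sample_cube : {ae mu, forall x, cube r x} ->
  {ae P, forall w, forall i, cube r (X i w)}.
Proof.
move=> mur; apply: filter_forall => i.
exact: (ae_law (measurable_funP (X i)) (Xiid.2 i) mur).
Qed.

Definition sampling_cst := d%:R * (2 * r) * (2 + 2 ^+ d).

Lemma expected_cell_distance : exists2 K : nat, (0 < K)%N &
  (\int[P]_w (d%:R * (2 * r / K%:R) + d%:R * (2 * r) *
      label_gap (grid r K) mu (empirical_measure R (fun i => X i w)))%:E
    <= (sampling_cst * mesh R d N)%:E)%E.
Proof.
have r0 := ltW hr.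
have [K K0 [KN cardN]] := grid_size R d N0.
exists K => //.
have c0 : 0 <= d%:R * (2 * r) by rewrite !mulr_ge0.
have g0 w := label_gap_ge0 (grid r K) mu (empirical_measure R (fun i => X i w)).
have mg := measurable_empirical_label_gap mu X (@measurable_grid R d r K).
have eta0 : 0 <= d%:R * (2 * r / K%:R) by rewrite mulr_ge0// divr_ge0// mulr_ge0.
rewrite ge0_integral_affine//.
have lam0 : 0 < N%:R `^ (- (3 / 4)) :> R by rewrite powR_gt0// ltr0n.
have Eg : (\int[P]_w (label_gap (grid r K) mu (empirical_measure R (fun i => X i w)))%:E <= (2 ^+ d * mesh R d N)%:E)%E.
  apply: le_trans (expected_label_gap N0 Xiid (@measurable_grid R d r K) lam0) _.
  by rewrite card_grid lee_fin; exact: deviation_mesh.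
apply: le_trans (leeD (lexx _) (lee_wpmul2l _ Eg)) _; first by rewrite lee_fin.
rewrite -EFinM -EFinD lee_fin /sampling_cst.
have := ler_wpM2l c0 KN; rewrite !mulrA; lra.
Qed.

End expected_bound.

Theorem theorem3p17 (R : realType) (M r : R) (d : nat)
    (hM : 0 < M) (hr : 0 < r) (hd : (0 < d)%N) :
  exists C : R, 0 < C /\
    forall mu nu : probability 'rV[R]_d R,
      compactly_supported_in mu (@eucl_ball R d r) ->
      compactly_supported_in nu (@eucl_ball R d r) ->
      has_density_bounded_by mu M ->
    forall n m : nat, (0 < n)%N -> (0 < m)%N ->
    forall (disp : measure_display) (Omega : measurableType disp)
      (P : probability Omega R)
      (X : 'I_n -> {RV P >-> 'rV[R]_d}) (Y : 'I_m -> {RV P >-> 'rV[R]_d}),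
      iid_sample X mu ->
      iid_sample Y nu ->
    forall (gammahat : Omega -> probability ('rV[R]_d * 'rV[R]_d)%type R)
      (gamma : probability ('rV[R]_d * 'rV[R]_d)%type R),
      (forall w, optimal_coupling (empirical_measure R (fun i => X i w))
                   (empirical_measure R (fun j => Y j w)) (gammahat w)) ->
      optimal_coupling mu nu gamma ->
    (\int[P]_w W2 (@eucl_dist_prod R d) gamma (gammahat w) <=
       (C * rate R d n m)%:E)%E.
Proof.
have r0 := ltW hr.
pose A1 := step_cst M r d; pose A2 := deviation_cst r d; pose A3 := sampling_cst r d.
have A1_gt0 : 0 < A1.
  rewrite /A1 /step_cst ltr_wpDl// !mulr_ge0 ?exprn_ge0 ?mulr_ge0//; exact: ltW.
have A2_ge0 : 0 <= A2 by rewrite /A2 /deviation_cst !mulr_ge0// addr_ge0// !mulr_ge0.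
have A3_ge0 : 0 <= A3 by rewrite /A3 /sampling_cst !mulr_ge0// addr_ge0// exprn_ge0.
have A_gt0 : 0 < A1 + A2 * A3 by rewrite ltr_wpDr// mulr_ge0.
exists (8 * (A1 + A2 * A3)); split; first by rewrite mulr_gt0.
move=> mu nu mu_supp nu_supp mu_density n m n0 m0 disp Omega P X Y Xiid Yiid.
move=> gammahat gamma gammahat_opt gamma_opt.
have [K1 K1_gt0 E1] := expected_cell_distance hr n0 Xiid.
have [K2 K2_gt0 E2] := expected_cell_distance hr m0 Yiid.
pose sigma := mesh R d n + mesh R d m.
have sigma_gt0 : 0 < sigma by rewrite addr_gt0 ?mesh_gt0.
(* the expected label gaps are of order [sigma = s ^+ 4], and [s ^+ 4 / s ^+ 3 = s] *)
pose s := sigma `^ 4^-1.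
have s0 : 0 < s by rewrite powR_gt0.
have s4 : s ^+ 4 = sigma.
  by rewrite -powR_mulrn ?ltW// -powRrM mulVf ?pnatr_eq0// powRr1// ltW.
have s2 : s ^+ 2 <= 2.
  have : s ^+ 4 <= 2 by rewrite s4 /sigma; have := mesh_le1 R d n0; have := mesh_le1 R d m0; lra.
  rewrite (_ : s ^+ 4 = (s ^+ 2) ^+ 2); last by rewrite -exprM.
  have := sqr_ge0 (s ^+ 2 - 1); rewrite sqrrB expr1n; nra.
pose g1 w := d%:R * (2 * r / K1%:R) + d%:R * (2 * r) *
  label_gap (grid r K1) mu (empirical_measure R (fun i => X i w)).
pose g2 w := d%:R * (2 * r / K2%:R) + d%:R * (2 * r) *
  label_gap (grid r K2) nu (empirical_measure R (fun j => Y j w)).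
have g1_ge0 w : 0 <= g1 w.
  by rewrite addr_ge0// mulr_ge0 ?divr_ge0 ?mulr_ge0//; exact: label_gap_ge0.
have g2_ge0 w : 0 <= g2 w.
  by rewrite addr_ge0// mulr_ge0 ?divr_ge0 ?mulr_ge0//; exact: label_gap_ge0.
have mg1 : measurable_fun setT g1.
  by apply: measurable_funD => //; apply: measurable_funM => //;
    exact: (measurable_empirical_label_gap mu X (@measurable_grid R d r K1)).
have mg2 : measurable_fun setT g2.
  by apply: measurable_funD => //; apply: measurable_funM => //;
    exact: (measurable_empirical_label_gap nu Y (@measurable_grid R d r K2)).
have As0 : 0 <= A1 * s by rewrite mulr_ge0// ltW.
have Ads0 : 0 <= A2 / s ^+ 3 by rewrite divr_ge0// exprn_ge0// ltW.
have mg : measurable_fun setT (fun w => g1 w + g2 w) by exact: measurable_funD.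
apply: (@le_trans _ _ (\int[P]_w (A1 * s + A2 / s ^+ 3 * (g1 w + g2 w))%:E)%E).
  apply: ge0_ae_lower_integral_le => //.
  - by move=> w; exact: poweR_ge0.
  - by move=> w; rewrite lee_fin addr_ge0// mulr_ge0// addr_ge0.
  - apply/measurable_EFinP; apply: measurable_funD => //.
    exact: measurable_funM.
  have := ae_sample_cube Xiid (ae_cube mu_supp).
  have := ae_sample_cube Yiid (ae_cube nu_supp).
  apply: filterS2 => w Yr Xr.
  exact: (W2_empirical_le hM hr mu_supp nu_supp mu_density gamma_opt Xr Yr
    (gammahat_opt w) K1_gt0 K2_gt0 s0 s2).
rewrite ge0_integral_affine//; last by move=> w; rewrite addr_ge0.
under eq_integral do rewrite EFinD.
rewrite ge0_integralD//; last 4 first.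
- by move=> w _; rewrite lee_fin.
- exact/measurable_EFinP.
- by move=> w _; rewrite lee_fin.
- exact/measurable_EFinP.
apply: (@le_trans _ _ (A1 * s + A2 / s ^+ 3 * (A3 * sigma))%:E).
  rewrite [leRHS]EFinD; apply: leeD => //.
  rewrite [leRHS]EFinM; apply: lee_wpmul2l => //.
  by rewrite /sigma mulrDr EFinD; exact: leeD.
rewrite lee_fin -s4 (_ : _ + _ = (A1 + A2 * A3) * s); last by field; rewrite gt_eqF.
rewrite (mulrC 8) -(mulrA (A1 + _)) (ler_pM2l A_gt0).
exact: mesh_rate.
Qed.
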